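(* Let $0<\alpha\le\frac12$ and let $r_0,r_1,r_2,r_3\in\mathcal N_1$ with $r_0=\mathbf 1_1$ satisfy $\rho_1(r_j^*r_k)=\delta_{jk}$ (resp. $\rho_1(r_jr_k^* )=\delta_{jk}$) for $0\le j,k\le 3$. Then the left (resp. right) Haar system $\mathbf h_\alpha=\mathbf h_\alpha(r_0,r_1,r_2,r_3)=\{h_j\}_{j\ge0}$ is a Schauder basis of the Banach space $\mathcal R_{\alpha,\sharp}$ (resp. $\mathcal R_{\alpha,\flat}$).
   Context: For a von Neumann algebra $\mathcal M$ with faithful normal state $\rho$, put $\|x\|_\sharp=\|\rho(\cdot\,x)\|_{\mathcal M_*}$ and $\|x\|_\flat=\|\rho(x\,\cdot)\|_{\mathcal M_*}$, $x\in\mathcal M$; $\mathcal M_\sharp$ and $\mathcal M_\flat$ are the completions of $\mathcal M$ in these norms. Both are isometric to the predual $\mathcal M_*$ (via $x\mapsto\rho(\cdot\,x)$, resp. $x\mapsto\rho(x\,\cdot)$). For $\nu\ge1$ let $\mathcal N_\nu$ be the algebra of complex $2^\nu\times2^\nu$ matrices with unit $\mathbf 1_\nu$, with $\mathcal N_\nu\otimes\mathcal N_\mu=\mathcal N_{\nu+\mu}$ via the Kronecker product; $\rho_\nu(x)=\mathrm{Tr}(xA_\nu)$, where $A_\nu=\bigotimes_{k=1}^\nu\begin{pmatrix}\alpha&0\\0&1-\alpha\end{pmatrix}$; and $i_\nu:\mathcal N_\nu\to\mathcal N_{\nu+1}$, $i_\nu(x)=x\otimes\mathbf 1_1$. $\mathcal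 R_\alpha$ is the von Neumann algebra generated by the GNS representation of the $C^*$-inductive limit of $(\mathcal N_\nu,i_\nu)$ with respect to the state $\rho_\alpha$ induced by the states $\rho_\nu$; it carries the faithful normal state $\rho_\alpha$, and $\pi_\nu:\mathcal N_\nu\to\mathcal R_\alpha$ are the canonical embeddings, with $\rho_\alpha\circ\pi_\nu=\rho_\nu$ and $\pi_{\nu+1}\circ i_\nu=\pi_\nu$. It is the hyperfinite factor of type $\mathrm{III}_\lambda$, $\lambda=\frac{\alpha}{1-\alpha}$, if $0<\alpha<\frac12$, and of type $\mathrm{II}_1$ if $\alpha=\frac12$. Matrix units in shell enumeration: $\{e^{(\nu)}_m\}_{0\le m<4^\nu}$, where the matrix unit with entry $1$ in row $a$, column $b$ ($1\le a,b\le2^\nu$) gets index $m=s(a,b)-1$, with $s(a,b)=(b-1)^2+a$ if $a\le b$ and $s(a,b)=a^2-b+1$ if $a>b$. Haar system: $\mathbf h_1=\{r_0,r_1,r_2,r_3\}$ and, inductively, for $j=4^\nu q+k$ with $0\le q\le3$, $0\le k<4^\nu$, $h^{(\nu+1)}_j=i_\nu(h^{(\nu)}_k)(\mathbf 1_\nu\otimes r_0)$ if $q=0$ and $h^{(\nu+1)}_j=i_\nu(e^{(\nu)}_k)(\mathbf 1_\nu\otimes r_q)$ if $q\ne0$. It is called left if $\rho_1(r_j^*r_k)=\delta_{jk}$ and right if $\rho_1(r_jr_k^* )=\delta_{jk}$. When $r_0=\mathbf 1_1$, one has $h^{(\nu+1)}_j=i_\nu(h^{(\nu)}_j)$ for $0\le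 j<4^\nu$, and $\mathbf h_\alpha=\{h_j\}_{j\ge0}\subseteq\mathcal R_\alpha$ is defined by $h_j=\pi_\nu(h^{(\nu)}_j)$ for any $\nu$ with $j<4^\nu$. *)

(* Defs.v *)
(* MathComp and MathComp-Analysis; the complex field is R[i], R : realType. *)
From HB Require Import structures.
From mathcomp Require Import all_boot all_order all_algebra.
From mathcomp Require Import boolp classical_sets functions reals topology.
From mathcomp Require Import normedtype sequences.
From mathcomp Require Import complex mxtens.

Set Implicit Arguments.
Unset Strict Implicit.
Unset Printing Implicit Defensive.

Import Order.TTheory GRing.Theory Num.Theory.
Import numFieldNormedType.Exports.

Local Open Scope classical_set_scope.
Local Open Scope ring_scope.
Local Open Scope complex_scope.

(* The product is a field of the mixin, because a structure
   joining GRing.Algebra with a normed module is rejected by HB (missing join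
   with Num.NumDomain). *)
HB.mixin Record isCStarAlgebra (R : realType) (A : Type)
    of CompleteNormedModule R[i] A := {
  cmul : A -> A -> A;
  cone : A;
  star : A -> A;
  cmulA : associative cmul;
  cmul1x : left_id cone cmul;
  cmulx1 : right_id cone cmul;
  cmul_linearl : forall y, linear (cmul ^~ y);
  cmul_linearr : forall x, linear (cmul x);
  cnormM : forall x y, `|cmul x y| <= `|x| * `|y|;
  starK : involutive star;
  starD : {morph star : x y / x + y};
  starZ : forall (c : R[i]) x, star (c *: x) = c^* *: star x;
  starM : forall x y, star (cmul x y) = cmul (star y) (star x);
  cstar_identity : forall x, `|cmul (star x) x| = `|x| ^+ 2
}.

#[short(type="cstarAlgType")]
HB.structure Definition CStarAlgebra (R : realType) :=
  {A of isCStarAlgebra R A & CompleteNormedModule R[i] A}.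

(* inner is linear in its first argument. *)
HB.mixin Record isHilbert (R : realType) (H : Type)
    of CompleteNormedModule R[i] H := {
  inner : {dot H for Num.conj};
  inner_norm : forall x : H, inner x x = `|x| ^+ 2
}.

#[short(type="hilbertType")]
HB.structure Definition Hilbert (R : realType) :=
  {H of isHilbert R H & CompleteNormedModule R[i] H}.

Section Operators.
Variables (R : realType) (H : hilbertType R).
Implicit Types (S M : set (H -> H)) (x y : H -> H).

Definition bounded_op x : Prop := linear x /\ continuous x.

Definition commutant S : set (H -> H) :=
  [set x | bounded_op x /\ forall s, S s -> x \o s = s \o x].

(* The von Neumann algebra generated by S is its bicommutant when S is closed
   under adjoints, as the range of a *-representation is. *)
Definition vn_generated S : set (H -> H) := commutant (commutant S).

Definition vector_state (Omega : H) (x : H -> H) : R[i] :=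
  inner (x Omega) Omega.

(* The norm of the functional f on M, as an element of the dual of M; when f is
   normal this is its norm in the predual. *)
Definition functional_norm M (f : (H -> H) -> R[i]) : R :=
  sup [set complex.Re `|f y| | y in [set y | M y /\ forall v, `|y v| <= `|v|]].

Definition sharp_norm M (rho : (H -> H) -> R[i]) (x : H -> H) : R :=
  functional_norm M (fun y => rho (y \o x)).

Definition flat_norm M (rho : (H -> H) -> R[i]) (x : H -> H) : R :=
  functional_norm M (fun y => rho (x \o y)).

(* B, with iota : M -> B, is a completion of M for the norm nrm. The values of
   iota and nrm outside M are irrelevant. *)
Record is_completion M (nrm : (H -> H) -> R)
    (B : completeNormedModType R[i]) (iota : (H -> H) -> B) : Prop := {
  completion_linear : forall (c : R[i]) x y, M x -> M y ->
    iota (c *: x + y) = c *: iota x + iota y;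
  completion_norm : forall x, M x -> `|iota x| = (nrm x)%:C;
  completion_dense : closure (iota @` M) = [set: B]
}.

End Operators.

Definition schauder_basis (R : realType) (B : completeNormedModType R[i])
    (e : nat -> B) : Prop :=
  forall b : B, exists! c : nat -> R[i],
    series (fun k => c k *: e k) @ \oo --> b.

Section States.
Variables (R : realType) (A : cstarAlgType R).

(* state_le_norm and state1 together say that phi has norm one. *)
Record is_state (phi : A -> R[i]) : Prop := {
  state_linear : scalar phi;
  state_positive : forall a, 0 <= phi (cmul (star a) a);
  state_le_norm : forall a, `|phi a| <= `|a|;
  state1 : phi cone = 1
}.

(* (H, Pi, Omega) is the GNS triple of phi, which is determined up to unitary
   equivalence by these properties. *)
Record is_gns (phi : A -> R[i]) (H : hilbertType R)
    (Pi : A -> H -> H) (Omega : H) : Prop := {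
  gns_bounded : forall a, bounded_op (Pi a);
  gns_linear : linear Pi;
  gns_one : Pi cone = id;
  gns_mul : forall a b, Pi (cmul a b) = Pi a \o Pi b;
  gns_star : forall a v w, inner (Pi a v) w = inner v (Pi (star a) w);
  gns_cyclic : closure (range (fun a => Pi a Omega)) = [set: H];
  gns_state : forall a, phi a = inner (Pi a Omega) Omega
}.

End States.

Section Matrices.
Variable R : realType.

Definition N (nu : nat) : Type := 'M[R[i]]_(2 ^ nu).

Definition adj_mx nu (x : N nu) : N nu := map_mx Num.conj x^T.

(* The Kronecker product with a factor of N 1, N nu (x) N 1 = N (nu + 1). *)
Definition kron nu (x : N nu) (y : N 1) : N nu.+1 :=
  castmx (esym (expnSr 2 nu), esym (expnSr 2 nu)) (x *t y).

Definition incl nu (x : N nu) : N nu.+1 := kron x 1%:M.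

Definition density1 (alpha : R) : N 1 :=
  diag_mx (\row_(a < 2) (if a == 0 then alpha else 1 - alpha)%:C).

Fixpoint density (alpha : R) (nu : nat) : N nu :=
  if nu is nu'.+1 then kron (density alpha nu') (density1 alpha) else 1%:M.

Definition rho (alpha : R) (nu : nat) (x : N nu) : R[i] :=
  \tr (x *m density alpha nu).

(* a, b are 1-based; the subtraction is never truncated. *)
Definition shell (a b : nat) : nat :=
  if (a <= b)%N then ((b - 1) ^ 2 + a)%N else (a ^ 2 - b + 1)%N.

(* For m < 4 ^ nu exactly one entry is 1; the 'I_(2 ^ nu) indices are 0-based. *)
Definition shell_unit (nu m : nat) : N nu :=
  \matrix_(a, b) ((shell a.+1 b.+1 - 1)%N == m)%:R.

(* The system at level nu, meaningful for 0 < nu and j < 4 ^ nu. *)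
Fixpoint haar (r : 'I_4 -> N 1) (nu : nat) : nat -> N nu :=
  match nu return nat -> N nu with
  | 0 => fun=> 1%:M
  | nu'.+1 =>
    match nu' return (nat -> N nu') -> nat -> N nu'.+1 with
    | 0 => fun=> fun j => r (inord j)
    | mu => fun h j =>
      let q := (j %/ 4 ^ mu)%N in let k := (j %% 4 ^ mu)%N in
      (if q == 0%N then incl (h k) else incl (shell_unit mu k))
        *m kron 1%:M (r (inord q))
    end (haar r nu')
  end.

Definition left_orthonormal (alpha : R) (r : 'I_4 -> N 1) : Prop :=
  forall j k, rho alpha (adj_mx (r j) *m r k) = (j == k)%:R.

Definition right_orthonormal (alpha : R) (r : 'I_4 -> N 1) : Prop :=
  forall j k, rho alpha (r j *m adj_mx (r k)) = (j == k)%:R.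

(* The index set of the inductive system is nu >= 1: iota 0 is irrelevant. The
   maps iota nu are isometric, being injective *-homomorphisms. *)
Record is_inductive_limit (A : cstarAlgType R) (iota : forall nu, N nu -> A)
    : Prop := {
  limit_linear : forall nu, (0 < nu)%N -> linear (@iota nu);
  limit_one : forall nu, (0 < nu)%N -> iota nu 1%:M = cone;
  limit_mul : forall nu, (0 < nu)%N ->
    forall x y, iota nu (x *m y) = cmul (iota nu x) (iota nu y);
  limit_star : forall nu, (0 < nu)%N ->
    forall x, iota nu (adj_mx x) = star (iota nu x);
  limit_inj : forall nu, (0 < nu)%N -> injective (@iota nu);
  limit_compat : forall nu, (0 < nu)%N ->
    forall x, iota nu.+1 (incl x) = iota nu x;
  limit_dense :
    closure (\bigcup_(nu in [set nu | (0 < nu)%N]) range (@iota nu)) = [set: A]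
}.

(* j < 4 ^ j.+1; haar_limitE shows that any other nu with j < 4 ^ nu gives the
   same element. *)
Definition haar_limit (T : Type) (pi : forall nu, N nu -> T)
    (r : 'I_4 -> N 1) (j : nat) : T :=
  pi j.+1 (haar r j.+1 j).

Lemma haarS (r : 'I_4 -> N 1) nu j : r ord0 = 1%:M -> (0 < nu)%N ->
  (j < 4 ^ nu)%N -> haar r nu.+1 j = incl (haar r nu j).
Proof.
case: nu => [//|nu] r0 _ jlt; rewrite [LHS]/=.
rewrite divn_small // modn_small // eqxx.
have -> : inord 0 = ord0 :> 'I_4 by apply: val_inj; rewrite /= inordK.
rewrite r0 /kron; set c := (X in castmx X (1%:M *t 1%:M)).
suff -> : castmx c (1%:M *t 1%:M) = 1%:M :> N nu.+2 by rewrite mulmx1.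
apply/matrixP => a b; rewrite castmxE /= !mxE /=.
rewrite -natrM mulnb; congr (_%:R); congr nat_of_bool.
rewrite -xpair_eqE; set u := cast_ord _ a; set v := cast_ord _ b.
rewrite -[_ == (_, _)]/(mxtens_unindex u == mxtens_unindex v).
by rewrite (can_eq (@mxtens_unindexK _ _)) /u /v (inj_eq (@cast_ord_inj _ _ _)).
Qed.

Lemma haar_limitE (T : Type) (pi : forall nu, N nu -> T) (r : 'I_4 -> N 1) :
    r ord0 = 1%:M ->
    (forall nu, (0 < nu)%N -> forall x, pi nu.+1 (incl x) = pi nu x) ->
  forall nu j, (0 < nu)%N -> (j < 4 ^ nu)%N ->
  haar_limit pi r j = pi nu (haar r nu j).
Proof.
move=> r0 piS.
have up d mu j : (0 < mu)%N -> (j < 4 ^ mu)%N ->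
    pi (d + mu)%N (haar r (d + mu)%N j) = pi mu (haar r mu j).
  move=> mu0 jmu; elim: d => [//|d <-]; rewrite addSn haarS ?piS ?addn_gt0 ?mu0 ?orbT //.
  by apply: leq_trans jmu _; rewrite leq_exp2l // leq_addl.
move=> nu j nu0 jnu; rewrite /haar_limit.
have jj : (j < 4 ^ j.+1)%N by apply: ltn_trans (ltn_expl j.+1 _) => //.
by rewrite -(up nu _ _ _ jj) // -(up j.+1 _ _ nu0 jnu) addnC.
Qed.

End Matrices.

(* Main.v *)
Require Import Defs.
From HB Require Import structures.
From mathcomp Require Import all_boot all_order all_algebra.
From mathcomp Require Import boolp classical_sets functions reals topology.
From mathcomp Require Import normedtype sequences.
From mathcomp Require Import complex mxtens.
From mathcomp Require Import spectral.
From mathcomp Require Import zify ring.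

Set Implicit Arguments.
Unset Strict Implicit.
Unset Printing Implicit Defensive.

Import Order.TTheory GRing.Theory Num.Theory.
Import numFieldNormedType.Exports.

Local Open Scope classical_set_scope.
Local Open Scope ring_scope.
Local Open Scope complex_scope.

Local Notation incl := Defs.incl.

(** The proof is the classical criterion for Schauder bases: the [h j] do not
vanish, their span is dense, and the truncations of a finite expansion are
bounded by the expansion, uniformly in its length. The criterion is
[schauder_basis_criterion].

Let [M] be the von Neumann algebra. Both norms come from a functional, [rho (y x)]
for the sharp and [rho (x y)] for the flat one, [y] running over the unit ball of
[M]. On matrices of level [nu] either functional is
[\sum_(a, b) y b a * w a b * x a b], with the weight [w a b] an eigenvalue of the
density indexed by [b] or by [a]. These weights are positive and
multiplicative over tensor products, and nothing else distinguishes the two sides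
([pairing]). From the orthonormality of the [r q] only three facts survive, the
same on both sides: the [r q] form a basis with a known dual basis, [r 0] is the
unit, and the [r q] with [q != 0] are centred for the state.

Truncations at a finite level ([bounded_pairing_trunc]). Write an expansion of
level [nu + 1] as the sum of the tensors of [x q] with [r q]. Then [x 0] is its
conditional expectation onto level [nu], which costs no constant, so that
truncations before [4 ^ nu] are handled by induction. The truncations beyond
keep the whole of [x 0] and truncate each other [x q] in the shell enumeration of
the matrix units. Passing from the expansion to [x q] and back costs a constant
depending on [alpha] and [r] only. Finally an initial segment of the shells is
the union of a square, a piece of a column and a piece of a row, and compressing a
contraction to a rectangle of entries gives a contraction.

From matrices to the algebra ([pairing_side_norm], [side_norm_pi_le]). A
contractive matrix acts as a contraction on the Hilbert space since
[1 - y^* y] is of the form [c^* c]. Conversely a contraction [y] in [M] has a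
conditional expectation [y'] on level [nu] which induces the same functional
there. Its contractivity rests on the KMS relation
[phi (x a) = phi (b x)], where [a D = D b] for the density [D]: it makes
right multiplication by matrices a bounded operator in the commutant of the
representation, with which [y] commutes by definition of the bicommutant.
The matrix [y'] is then the compression of [y] to the span of the vectors
[E p s Omega] for any fixed [s].

Density ([dense_levels]). The sharp norm of [x] is at most the norm of [x Omega],
and the vectors [pi z Omega] are dense in the Hilbert space. For the flat norm
the functional [v |-> inner (x v) Omega] has to be approximated instead; it is
nearly represented by a vector [w], and [w] is close to some [pi z Omega]. *)

(** * Shell enumeration *)

Section ShellEnumeration.

(** The index of the matrix unit in row [a], column [b], all counted from 0. *)
Definition shell0 (a b : nat) : nat := (shell a.+1 b.+1 - 1)%N.

Lemma shell0E a b :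
  shell0 a b = (if (a <= b)%N then b * b + a else a * a + 2 * a - b)%N.
Proof.
rewrite /shell0 /shell ltnS -!mulnn; case: ifP => H.
  by rewrite !subSS !subn0 addnS subSS subn0.
by rewrite addnK mulSn mulnS; lia.
Qed.

Lemma shell0_lt m a b : (a < m)%N -> (b < m)%N -> (shell0 a b < m * m)%N.
Proof. by move=> am bm; rewrite shell0E; case: ifP => ?; nia. Qed.

Lemma shell0_inj a b a' b' : shell0 a b = shell0 a' b' -> a = a' /\ b = b'.
Proof.
rewrite !shell0E.
case: (leqP a b) => h; case: (leqP a' b') => h' e.
- have ebb' : b = b' by case: (ltngtP b b') => // ?; nia.
  by subst b'; split=> //; lia.
- by case: (ltngtP b a') => ?; nia.
- by case: (ltngtP b' a) => ?; nia.
- have eaa' : a = a' by case: (ltngtP a a') => // ?; nia.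
  by subst a'; split=> //; lia.
Qed.

(** With [s * s] the largest square up to [n], the segment consists of the square
of side [s], the first [t] entries of the next column, and, once the corner is
passed, the entries of the next row that come last. *)
Lemma shell0_initial n : exists s t, forall a b, ((shell0 a b < n)%N : nat) =
  (((a < s) && (b < s)) + ((a < t) && (a <= s) && (b == s)) +
   ((a == s) && (2 * s < b + t) && (b < s)))%N.
Proof.
have [s [ss sS]] : exists s, (s * s <= n < s.+1 * s.+1)%N /\ True.
  elim: n => [|n [s [/andP[h1 h2] _]]]; first by exists 0%N.
  case: (leqP (s.+1 * s.+1) n.+1) => h; [exists s.+1|exists s]; split=> //; nia.
exists s, (n - s * s)%N => a b; rewrite shell0E.
case/andP: ss => h1 h2.
case: (leqP a b) => hab.
  case: (ltngtP b s) => hb.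
  - have -> : (a < s)%N by lia.
    have -> : (b * b + a < n)%N by nia.
    have -> : (a == s) = false by lia.
    by rewrite /= !andbF.
  - have -> : (b * b + a < n)%N = false by nia.
    by rewrite !andbF.
  - by subst b; rewrite !andbF !andbT /=; case: (leqP a s) => ?; lia.
case: (ltngtP a s) => ha.
- have -> : (a * a + 2 * a - b < n)%N by nia.
  have -> : (b < s)%N by lia.
  have -> : (b == s) = false by lia.
  by rewrite !andbF.
- have -> : (a * a + 2 * a - b < n)%N = false by nia.
  by rewrite !andbF.
- subst a; have -> : (b < s)%N by lia.
  have -> : (b == s) = false by lia.
  by rewrite !andbF !andbT /= add0n; nia.
Qed.

End ShellEnumeration.

(** * Tensor indices, blocks and contractions *)

Section TensorIndices.
Variable R : realType.
Implicit Types nu : nat.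
Notation N := (N R).

Definition pidx nu (a : 'I_(2 ^ nu)) (i : 'I_(2 ^ 1)) : 'I_(2 ^ nu.+1) :=
  cast_ord (esym (expnSr 2 nu)) (mxtens_index (a, i)).

Lemma pidx_eq nu a i a' i' :
  (@pidx nu a i == pidx a' i') = (a == a') && (i == i').
Proof.
rewrite /pidx (inj_eq (@cast_ord_inj _ _ _)) (can_eq (@mxtens_indexK _ _)).
by rewrite xpair_eqE.
Qed.

Lemma pidx_surj nu (x : 'I_(2 ^ nu.+1)) : exists a i, x = pidx a i.
Proof.
exists (mxtens_unindex (cast_ord (expnSr 2 nu) x)).1.
exists (mxtens_unindex (cast_ord (expnSr 2 nu) x)).2.
by rewrite /pidx -surjective_pairing mxtens_unindexK cast_ord_comp cast_ord_id.
Qed.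

Lemma sum_pidx nu (V : nmodType) (F : 'I_(2 ^ nu.+1) -> V) :
  \sum_x F x = \sum_a \sum_i F (@pidx nu a i).
Proof.
rewrite pair_bigA /= (reindex (fun p : _ * _ => @pidx nu p.1 p.2)) //=.
apply: onW_bij; apply: inj_card_bij.
  by move=> [a i] [b j] /eqP /=; rewrite pidx_eq => /andP[/eqP -> /eqP ->].
by rewrite card_prod !card_ord expnSr.
Qed.

Lemma pidx_mxP nu (X Y : N nu.+1) :
  (forall a i b j, X (pidx a i) (pidx b j) = Y (pidx a i) (pidx b j)) -> X = Y.
Proof.
move=> e; apply/matrixP => x y.
by have [a [i ->]] := pidx_surj x; have [b [j ->]] := pidx_surj y.
Qed.

Lemma kronE nu (x : N nu) (y : N 1) a i b j :
  kron x y (pidx a i) (pidx b j) = x a b * y i j.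
Proof.
rewrite /kron castmxE /pidx !cast_ord_comp !cast_ord_id.
by rewrite !mxE !mxtens_indexK.
Qed.

Lemma kron_mulmx nu (x x' : N nu) (y y' : N 1) :
  kron x y *m kron x' y' = kron (x *m x') (y *m y').
Proof.
apply: pidx_mxP => a i b j; rewrite kronE !mxE sum_pidx big_distrl /=.
apply: eq_bigr => c _; rewrite big_distrr /=; apply: eq_bigr => k _.
by rewrite !kronE mulrACA.
Qed.

Lemma kron_suml nu (I : finType) (P : pred I) (c : I -> R[i])
    (x : I -> N nu) (y : N 1) :
  kron (\sum_(k | P k) c k *: x k) y = \sum_(k | P k) c k *: kron (x k) y.
Proof.
apply: pidx_mxP => a i b j; rewrite kronE !summxE big_distrl /=.
by apply: eq_bigr => k _; rewrite !mxE kronE mulrA.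
Qed.

Lemma kron0l nu (y : N 1) : kron (0 : N nu) y = 0.
Proof. by apply: pidx_mxP => a i b j; rewrite kronE !mxE mul0r. Qed.

Lemma kron1l0 (y : N 1) : kron (1%:M : N 0) y = y.
Proof.
apply/matrixP => x x'; have [a [i ->]] := pidx_surj x.
have [b [j ->]] := pidx_surj x'; rewrite kronE !ord1 mxE eqxx mul1r.
by congr (y _ _); apply: val_inj.
Qed.

Definition block nu (i j : 'I_(2 ^ 1)) (X : N nu.+1) : N nu :=
  \matrix_(a, b) X (pidx a i) (pidx b j).

End TensorIndices.

Section Contractions.
Variable R : realType.
Notation N := (N R).
Notation C := R[i].

Definition sqn n (v : 'cV[C]_n) : C := \sum_a `|v a 0| ^+ 2.

(** Rectangular matrices are allowed so that compressions are products. *)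
Definition contr m n (y : 'M[C]_(m, n)) : Prop :=
  forall v, sqn (y *m v) <= sqn v.

Lemma sqn_ge0 n (v : 'cV[C]_n) : 0 <= sqn v.
Proof. by apply: sumr_ge0 => a _; rewrite exprn_ge0. Qed.

Lemma contrM m n p (x : 'M[C]_(m, n)) (y : 'M[C]_(n, p)) :
  contr x -> contr y -> contr (x *m y).
Proof. by move=> cx cy v; rewrite -mulmxA (le_trans (cx _)). Qed.

(** One tensor leg of a vector and the insertion of a leg: the two contractions
out of which all slices below are made. *)
Definition leg nu (i : 'I_(2 ^ 1)) : 'M[C]_(2 ^ nu, 2 ^ nu.+1) :=
  \matrix_(a, x) (x == pidx a i)%:R.

Lemma leg_mulmx nu i n (v : 'M[C]_(2 ^ nu.+1, n)) a c :
  (leg nu i *m v) a c = v (pidx a i) c.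
Proof.
rewrite mxE (bigD1 (pidx a i)) //= mxE eqxx mul1r big1 ?addr0 // => x nx.
by rewrite mxE (negbTE nx) mul0r.
Qed.

Lemma legT_mulmx nu i n (v : 'M[C]_(2 ^ nu, n)) a k c :
  ((leg nu i)^T *m v) (pidx a k) c = (k == i)%:R * v a c.
Proof.
rewrite mxE (bigD1 a) //= !mxE pidx_eq eqxx /= big1 ?addr0 // => b nb.
by rewrite !mxE pidx_eq eq_sym (negbTE nb) mul0r.
Qed.

Lemma sqn_legs nu (v : 'cV[C]_(2 ^ nu.+1)) : sqn v = \sum_i sqn (leg nu i *m v).
Proof.
rewrite /sqn sum_pidx exchange_big /=; apply: eq_bigr => i _.
by apply: eq_bigr => a _; rewrite leg_mulmx.
Qed.

Lemma contr_leg nu i : contr (leg nu i).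
Proof.
move=> v; rewrite [leRHS]sqn_legs (bigD1 i) //= lerDl.
by apply: sumr_ge0 => k _; rewrite sqn_ge0.
Qed.

Lemma contr_legT nu i : contr (leg nu i)^T.
Proof.
move=> v; rewrite /sqn sum_pidx; apply: ler_sum => a _.
rewrite (bigD1 i) //= legT_mulmx eqxx mul1r big1 ?addr0 // => k nk.
by rewrite legT_mulmx (negbTE nk) mul0r normr0 expr0n.
Qed.

Lemma kron_delta nu (y : N nu) i j :
  kron y (delta_mx i j) = (leg nu i)^T *m y *m leg nu j.
Proof.
apply: pidx_mxP => a k b l; rewrite -mulmxA legT_mulmx kronE mxE.
rewrite -[y *m _]trmxK trmx_mul mxE legT_mulmx mxE.
by case: eqP; case: eqP; rewrite /= ?(mul0r, mul1r, mulr0, mulr1).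
Qed.

Lemma blockE nu i j (X : N nu.+1) : block i j X = leg nu i *m X *m (leg nu j)^T.
Proof.
apply/matrixP => a b; rewrite -mulmxA leg_mulmx mxE.
by rewrite -[X *m _]trmxK trmx_mul trmxK mxE leg_mulmx mxE.
Qed.

Lemma contr_kron_delta nu (y : N nu) i j :
  contr y -> contr (kron y (delta_mx i j)).
Proof.
move=> cy; rewrite kron_delta; apply: contrM; last exact: contr_leg.
by apply: contrM => //; exact: contr_legT.
Qed.

Lemma contr_block nu i j (X : N nu.+1) : contr X -> contr (block i j X).
Proof.
move=> cX; rewrite blockE; apply: contrM; last exact: contr_legT.
by apply: contrM => //; exact: contr_leg.
Qed.

Lemma contr_incl nu (y : N nu) : contr y -> contr (incl y).
Proof.
move=> cy v; rewrite [sqn v]sqn_legs sqn_legs; apply: ler_sum => i _.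
suff -> : leg nu i *m (incl y *m v) = y *m (leg nu i *m v) by exact: cy.
apply/colP => a; rewrite leg_mulmx !mxE sum_pidx; apply: eq_bigr => b _.
rewrite leg_mulmx (bigD1 i) //= kronE mxE eqxx mulr1 big1 ?addr0 // => k nk.
by rewrite kronE mxE eq_sym (negbTE nk) mulr0 mul0r.
Qed.

Lemma contr_rect m n (y : 'M[C]_(m, n)) (p : pred 'I_m) (q : pred 'I_n) :
  contr y -> contr (\matrix_(a, b) ((p a && q b)%:R * y a b)).
Proof.
move=> cy v; pose w : 'cV[C]_n := \col_b ((q b)%:R * v b 0).
have -> : \matrix_(a, b) ((p a && q b)%:R * y a b) *m v =
          \col_a ((p a)%:R * (y *m w) a 0).
  apply/colP => a; rewrite !mxE big_distrr /=; apply: eq_bigr => b _.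
  by rewrite !mxE; case: (p a); case: (q b); rewrite /= ?(mul0r, mul1r, mulr0).
have mask k (P : pred 'I_k) (u : 'cV[C]_k) : sqn (\col_a ((P a)%:R * u a 0)) <= sqn u.
  apply: ler_sum => a _; rewrite mxE; case: (P a); rewrite ?mul1r // mul0r.
  by rewrite normr0 expr0n exprn_ge0.
by rewrite (le_trans (mask _ p _)) // (le_trans (cy _)) // mask.
Qed.

Lemma contr_delta n (a b : 'I_n) : contr (delta_mx a b : 'M[C]_n).
Proof.
move=> v; rewrite /sqn (bigD1 a) //= big1 => [|x nx]; last first.
  rewrite mxE big1 ?normr0 ?expr0n // => c _.
  by rewrite mxE (negbTE nx) mul0r.
rewrite addr0 mxE (bigD1 b) //= mxE !eqxx mul1r big1 => [|c nc]; last first.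
  by rewrite mxE eqxx (negbTE nc) mul0r.
rewrite addr0 [leRHS](bigD1 b) //= lerDl.
by apply: sumr_ge0 => c _; rewrite exprn_ge0.
Qed.

End Contractions.

(** * The twisted trace pairing *)

Section TwistedTracePairing.
Variables (R : realType) (alpha : R).
Hypothesis halpha : 0 < alpha < 1.
Notation N := (N R).
Notation C := R[i].

Definition side_index (T : Type) (s : bool) (i j : T) : T := if s then j else i.

Definition weight1 (s : bool) (i j : 'I_(2 ^ 1)) : C :=
  density1 alpha (side_index s i j) (side_index s i j).

Definition weight (s : bool) nu (a b : 'I_(2 ^ nu)) : C :=
  density alpha nu (side_index s a b) (side_index s a b).

(** For [s = true] this is the functional [rho (y x)], for [s = false] it is
[rho (x y)]; the two Haar systems only see the different weights. *)
Definition pairing (s : bool) nu (y x : N nu) : C :=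
  \sum_a \sum_b y b a * (weight s a b * x a b).

Lemma weight_pidx s nu (a b : 'I_(2 ^ nu)) i j :
  weight s (pidx a i) (pidx b j) = weight s a b * weight1 s i j.
Proof. by rewrite /weight /weight1; case: s; exact: kronE. Qed.

Lemma density1E (i j : 'I_(2 ^ 1)) :
  density1 alpha i j = (i == j)%:R * (if i == ord0 then alpha else 1 - alpha)%:C.
Proof.
rewrite /density1 !mxE; case: (i =P j) => [->|_]; last by rewrite mulr0n mul0r.
by rewrite mulr1n mul1r.
Qed.

Lemma density1_gt0 (i : 'I_(2 ^ 1)) : 0 < density1 alpha i i.
Proof.
rewrite density1E eqxx mul1r; case/andP: halpha => a0 a1.
by case: ifP => _; rewrite ltcR // subr_gt0.
Qed.

Lemma weight1_gt0 s i j : 0 < weight1 s i j.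
Proof. exact: density1_gt0. Qed.

Lemma density1_sum : \sum_(i < 2 ^ 1) density1 alpha i i = 1.
Proof.
rewrite big_ord_recl big_ord1 !density1E !eqxx !mul1r /=.
by rewrite -rmorphD /= addrC subrK.
Qed.

Lemma density_diag nu (a b : 'I_(2 ^ nu)) : a != b -> density alpha nu a b = 0.
Proof.
elim: nu a b => [|nu IH] x y; first by rewrite !ord1 eqxx.
have [a [i ->]] := pidx_surj x; have [b [j ->]] := pidx_surj y.
rewrite pidx_eq negb_and /= kronE => /orP[nab|nij].
  by rewrite IH // mul0r.
by rewrite density1E (negbTE nij) mul0r mulr0.
Qed.

Lemma density_gt0 nu (a : 'I_(2 ^ nu)) : 0 < density alpha nu a a.
Proof.
elim: nu a => [|nu IH] x; first by rewrite mxE eqxx.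
have [a [i ->]] := pidx_surj x.
by rewrite /= kronE mulr_gt0 // density1_gt0.
Qed.

Lemma weight_gt0 s nu (a b : 'I_(2 ^ nu)) : 0 < weight s a b.
Proof. exact: density_gt0. Qed.

Lemma rhoE nu (z : N nu) : rho alpha z = \sum_a z a a * density alpha nu a a.
Proof.
apply: eq_bigr => a _; rewrite mxE (bigD1 a) //= big1 ?addr0 // => b nb.
by rewrite density_diag ?mulr0.
Qed.

Lemma pairing_rho s nu (y x : N nu) :
  pairing s y x = rho alpha (if s then y *m x else x *m y).
Proof.
rewrite /pairing rhoE /weight; case: s => /=.
  rewrite exchange_big /=; apply: eq_bigr => b _; rewrite mxE big_distrl /=.
  by apply: eq_bigr => a _; rewrite mulrCA mulrC.
apply: eq_bigr => a _; rewrite mxE big_distrl /=.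
by apply: eq_bigr => b _; rewrite mulrCA mulrC [y _ _ * _]mulrC.
Qed.

Lemma pairing_linear s nu (y : N nu) (I : finType) (P : pred I) (c : I -> C)
    (x : I -> N nu) :
  pairing s y (\sum_(k | P k) c k *: x k) = \sum_(k | P k) c k * pairing s y (x k).
Proof.
rewrite /pairing.
under [RHS]eq_bigr => k _ do
  (rewrite big_distrr /=; under eq_bigr => a _ do rewrite big_distrr /=).
rewrite [RHS]exchange_big /=; apply: eq_bigr => a _.
rewrite [RHS]exchange_big /=; apply: eq_bigr => b _.
rewrite summxE !big_distrr /=; apply: eq_bigr => k _.
by rewrite mxE mulrCA [_ * (weight _ _ _ * _)]mulrCA; ring.
Qed.

Lemma pairingD s nu (y x x' : N nu) :
  pairing s y (x + x') = pairing s y x + pairing s y x'.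
Proof.
rewrite /pairing -big_split /=; apply: eq_bigr => a _.
by rewrite -big_split /=; apply: eq_bigr => b _; rewrite !mxE; ring.
Qed.

Lemma pairing_blocks s nu (Y X : N nu.+1) :
  pairing s Y X =
  \sum_i \sum_j weight1 s i j * pairing s (block j i Y) (block i j X).
Proof.
rewrite /pairing sum_pidx exchange_big /=; apply: eq_bigr => i _.
under eq_bigr => a _ do rewrite sum_pidx exchange_big /=.
rewrite exchange_big /=; apply: eq_bigr => j _.
rewrite big_distrr /=; apply: eq_bigr => a _.
rewrite big_distrr /=; apply: eq_bigr => b _.
by rewrite !mxE weight_pidx; ring.
Qed.

Lemma block_kron nu i j (z : N nu) (u : N 1) : block i j (kron z u) = u i j *: z.
Proof. by apply/matrixP => a b; rewrite !mxE kronE mulrC. Qed.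

Lemma pairingZr s nu (y x : N nu) c : pairing s y (c *: x) = c * pairing s y x.
Proof.
have := @pairing_linear s nu y 'I_1 predT (fun=> c) (fun=> x).
by rewrite !big_ord1.
Qed.

Lemma pairingZl s nu (y x : N nu) c : pairing s (c *: y) x = c * pairing s y x.
Proof.
rewrite /pairing big_distrr /=; apply: eq_bigr => a _.
by rewrite big_distrr /=; apply: eq_bigr => b _; rewrite mxE -mulrA.
Qed.

Lemma pairing_kronl s nu (y : N nu) (u : N 1) (X : N nu.+1) :
  pairing s (kron y u) X =
  \sum_i \sum_j weight1 s i j * u j i * pairing s y (block i j X).
Proof.
rewrite pairing_blocks; apply: eq_bigr => i _; apply: eq_bigr => j _.
by rewrite block_kron pairingZl mulrA.
Qed.

Lemma pairing_kronr s nu (Y : N nu.+1) (z : N nu) (u : N 1) :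
  pairing s Y (kron z u) =
  \sum_i \sum_j weight1 s i j * u i j * pairing s (block j i Y) z.
Proof.
rewrite pairing_blocks; apply: eq_bigr => i _; apply: eq_bigr => j _.
by rewrite block_kron pairingZr mulrA.
Qed.

(** A dual norm given by its upper bounds, which avoids suprema and makes sense at
level 0, where the inductive proofs start. *)
Definition bounded_pairing s nu (x : N nu) (K : C) : Prop :=
  forall y, contr y -> `|pairing s y x| <= K.

Lemma bounded_pairingD s nu (x x' : N nu) K K' :
  bounded_pairing s x K -> bounded_pairing s x' K' ->
  bounded_pairing s (x + x') (K + K').
Proof.
move=> bx bx' y cy; rewrite pairingD (le_trans (ler_normD _ _)) //.
by rewrite lerD ?bx ?bx'.
Qed.

Lemma bounded_pairing_sum s nu (I : finType) (P : pred I) (c : I -> C)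
    (x : I -> N nu) (K : I -> C) :
  (forall k, P k -> bounded_pairing s (x k) (K k)) ->
  bounded_pairing s (\sum_(k | P k) c k *: x k) (\sum_(k | P k) `|c k| * K k).
Proof.
move=> bx y cy; rewrite pairing_linear (le_trans (ler_norm_sum _ _ _)) //.
by apply: ler_sum => k Pk; rewrite normrM ler_wpM2l ?bx.
Qed.

Lemma bounded_pairing_block s nu i j (X : N nu.+1) K :
  bounded_pairing s X K -> bounded_pairing s (block i j X) ((weight1 s i j)^-1 * K).
Proof.
move=> bX y cy; have w0 := weight1_gt0 s i j.
rewrite ler_pdivlMl // -[X in X * _](gtr0_norm w0) -normrM.
have <- : pairing s (kron y (delta_mx j i)) X =
          weight1 s i j * pairing s y (block i j X).
  rewrite pairing_kronl (bigD1 i) //= (bigD1 j) //= !mxE !eqxx mulr1.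
  rewrite big1 => [|l nl]; last by rewrite mxE (negbTE nl) mulr0 mul0r.
  rewrite addr0 big1 ?addr0 // => k nk; rewrite big1 // => l _.
  by rewrite mxE (negbTE nk) andbF mulr0 mul0r.
by apply: bX; exact: contr_kron_delta.
Qed.

Lemma bounded_pairing_kron s nu (z : N nu) (u : N 1) K :
  bounded_pairing s z K ->
  bounded_pairing s (kron z u) ((\sum_i \sum_j `|weight1 s i j * u i j|) * K).
Proof.
move=> bz Y cY; rewrite pairing_kronr (le_trans (ler_norm_sum _ _ _)) //.
rewrite big_distrl; apply: ler_sum => i _; rewrite (le_trans (ler_norm_sum _ _ _)) //.
rewrite big_distrl; apply: ler_sum => j _; rewrite normrM ler_wpM2l //.
by apply: bz; exact: contr_block.
Qed.

Lemma bounded_pairing_ge0 s nu (x : N nu) K : bounded_pairing s x K -> 0 <= K.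
Proof.
move=> /(_ 0) b; apply: le_trans (b _) => // v.
by rewrite mul0mx /sqn big1 ?sqn_ge0 // => a _; rewrite mxE normr0 expr0n.
Qed.

Lemma weight1_diag s i : weight1 s i i = density1 alpha i i.
Proof. by rewrite /weight1; case: s. Qed.

(** The weights of the slices of a contraction are the eigenvalues of the
density, which are positive and add up to one. *)
Lemma bounded_pairing_incl s nu (z : N nu) K :
  bounded_pairing s z K -> bounded_pairing s (incl z) K.
Proof.
move=> bz Y cY.
have -> : pairing s Y (incl z) =
    \sum_i density1 alpha i i * pairing s (block i i Y) z.
  rewrite pairing_kronr; apply: eq_bigr => i _; rewrite (bigD1 i) //=.
  rewrite mxE eqxx mulr1 weight1_diag big1 ?addr0 // => j nj.
  by rewrite mxE eq_sym (negbTE nj) mulr0 mul0r.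
rewrite (le_trans (ler_norm_sum _ _ _)) //.
rewrite -[K]mul1r -density1_sum big_distrl /=; apply: ler_sum => i _.
rewrite normrM (gtr0_norm (density1_gt0 i)) ler_wpM2l ?(ltW (density1_gt0 i)) //.
by apply: bz; exact: contr_block.
Qed.

(** The sum is the conditional expectation of [X] onto the preceding level: the
map dual, for the pairing, to the inclusion. *)
Lemma bounded_pairing_expectation s nu (X : N nu.+1) K :
  bounded_pairing s X K ->
  bounded_pairing s (\sum_i density1 alpha i i *: block i i X) K.
Proof.
move=> bX y cy.
have -> : pairing s y (\sum_i density1 alpha i i *: block i i X) =
          pairing s (incl y) X.
  rewrite pairing_linear pairing_kronl; apply: eq_bigr => i _.
  rewrite [RHS](bigD1 i) //= [1%:M i i]mxE eqxx mulr1 weight1_diag big1 ?addr0 // => j nj.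
  by rewrite mxE (negbTE nj) mulr0 mul0r.
by apply: bX; exact: contr_incl.
Qed.

(** The entrywise restriction passes to the other argument of the pairing, where it
preserves contractions. *)
Lemma bounded_pairing_rect s nu (x : N nu) (p q : pred 'I_(2 ^ nu)) K :
  bounded_pairing s x K ->
  bounded_pairing s (\matrix_(a, b) ((p a && q b)%:R * x a b)) K.
Proof.
move=> bx y cy.
have -> : pairing s y (\matrix_(a, b) ((p a && q b)%:R * x a b)) =
          pairing s (\matrix_(b, a) ((q b && p a)%:R * y b a)) x.
  apply: eq_bigr => a _; apply: eq_bigr => b _; rewrite !mxE andbC; ring.
by apply: bx; exact: contr_rect.
Qed.

(** One [K] for each of the three rectangles that make up an initial segment. *)
Lemma bounded_pairing_shell s nu (x : N nu) n K :
  bounded_pairing s x K ->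
  bounded_pairing s (\matrix_(a, b) ((shell0 a b < n)%N%:R * x a b)) (K + K + K).
Proof.
move=> bx; have [u [t e]] := shell0_initial n.
have -> : \matrix_(a, b) ((shell0 a b < n)%N%:R * x a b) =
  \matrix_(a, b) (((a < u)%N && (b < u)%N)%:R * x a b) +
  \matrix_(a, b) (((a < t)%N && (a <= u)%N && (b == u :> nat))%:R * x a b) +
  \matrix_(a, b) (((a == u :> nat) && ((2 * u < b + t)%N && (b < u)%N))%:R * x a b).
  by apply/matrixP => a b; rewrite !mxE e !natrD !mulrDl andbA.
apply: bounded_pairingD; last first.
  exact: (bounded_pairing_rect (fun a => a == u :> nat)
    (fun b => (2 * u < b + t)%N && (b < u)%N)).
apply: bounded_pairingD.
  exact: (bounded_pairing_rect (fun a => (a < u)%N) (fun b => (b < u)%N)).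
exact: (bounded_pairing_rect (fun a => (a < t)%N && (a <= u)%N)
  (fun b => b == u :> nat)).
Qed.

End TwistedTracePairing.

(** * Truncated Haar expansions *)

Section HaarPartialSums.
Variables (R : realType) (alpha : R).
Hypothesis halpha : 0 < alpha < 1.
Notation N := (N R).
Notation C := R[i].
Variable r : 'I_4 -> N 1.
Hypothesis r0 : r ord0 = 1%:M.
Variable g : 'I_4 -> 'I_(2 ^ 1) -> 'I_(2 ^ 1) -> C.
(* What is kept of orthonormality, in a form that does not mention the side: [g]
gives the coordinates in the basis [r], and the [r q] with [q != 0] are centred. *)
Hypothesis g_dual : forall q k,
  \sum_(p : 'I_(2 ^ 1) * 'I_(2 ^ 1)) g q p.1 p.2 * r k p.1 p.2 = (q == k)%:R.
Hypothesis r_basis : forall u : N 1,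
  u = \sum_q (\sum_(p : 'I_(2 ^ 1) * 'I_(2 ^ 1)) g q p.1 p.2 * u p.1 p.2) *: r q.
Hypothesis r_centred : forall q,
  \sum_i density1 alpha i i * r q i i = (q == ord0)%:R.

Definition haar_sum nu (c : nat -> C) : N nu :=
  \sum_(j < 4 ^ nu) c j *: haar r nu j.

(** The matrices [x q] in the decomposition of a Haar expansion of the following
level as the sum of the tensors of [x q] and [r q]. *)
Definition layer nu (c : nat -> C) (q : 'I_4) : N nu :=
  if q == ord0 then haar_sum nu c
  else \sum_(k < 4 ^ nu) c (q * 4 ^ nu + k)%N *: shell_unit R nu k.

Definition trunc n (c : nat -> C) (j : nat) : C := if (j < n)%N then c j else 0.

Lemma haar_rec nu (q : 'I_4) k : (k < 4 ^ nu)%N ->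
  haar r nu.+1 (q * 4 ^ nu + k)%N =
  kron (if q == ord0 then haar r nu k else shell_unit R nu k) (r q).
Proof.
move=> hk; case: nu hk => [|nu] hk.
  move: hk; rewrite expn0 ltnS leqn0 => /eqP ->; rewrite muln1 addn0 /= inord_val.
  have -> : shell_unit R 0 0 = 1%:M by apply/matrixP => a b; rewrite !ord1 !mxE.
  by rewrite if_same kron1l0.
have -> : haar r nu.+2 (q * 4 ^ nu.+1 + k)%N =
  (if ((q * 4 ^ nu.+1 + k) %/ 4 ^ nu.+1)%N == 0%N
   then incl (haar r nu.+1 ((q * 4 ^ nu.+1 + k) %% 4 ^ nu.+1)%N)
   else incl (shell_unit R nu.+1 ((q * 4 ^ nu.+1 + k) %% 4 ^ nu.+1)%N)) *m
  kron 1%:M (r (inord ((q * 4 ^ nu.+1 + k) %/ 4 ^ nu.+1)%N)) by [].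
rewrite divnMDl ?expn_gt0 // divn_small // addn0 modnMDl modn_small // inord_val.
rewrite -[in RHS](inj_eq val_inj) /=.
by case: ifP => _; rewrite /incl kron_mulmx mulmx1 mul1mx.
Qed.

Lemma sum_digits nu (V : nmodType) (F : nat -> V) :
  \sum_(j < 4 ^ nu.+1) F j = \sum_(q < 4) \sum_(k < 4 ^ nu) F (q * 4 ^ nu + k)%N.
Proof.
rewrite pair_bigA /=.
rewrite (reindex (fun p : 'I_4 * 'I_(4 ^ nu) =>
  cast_ord (esym (expnS 4 nu)) (mxtens_index p))) /=; last first.
  apply: onW_bij; apply: inj_card_bij.
    by move=> p p' /cast_ord_inj /(can_inj (@mxtens_indexK _ _)).
  by rewrite card_prod !card_ord expnS.
by apply: eq_bigr => -[q k] _; congr (F _).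
Qed.

Lemma haar_sum_layers nu c :
  haar_sum nu.+1 c = \sum_q kron (layer nu c q) (r q).
Proof.
rewrite /haar_sum (@sum_digits _ _ (fun j => c j *: haar r nu.+1 j)).
apply: eq_bigr => q _; rewrite /layer.
under eq_bigr => k _ do rewrite haar_rec //.
rewrite -kron_suml; case: ifP => [/eqP ->|_] //.
Qed.

Lemma haar_sum0 c : haar_sum 0 c = c 0%N *: 1%:M.
Proof. exact: big_ord1. Qed.

Lemma block_haar_sum nu c i j :
  block i j (haar_sum nu.+1 c) = \sum_q r q i j *: layer nu c q.
Proof.
rewrite haar_sum_layers; apply/matrixP => a b; rewrite mxE !summxE.
by apply: eq_bigr => q _; rewrite kronE mxE mulrC.
Qed.

Lemma layer_dual nu c q :
  layer nu c q = \sum_(p : 'I_(2 ^ 1) * 'I_(2 ^ 1))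
                   g q p.1 p.2 *: block p.1 p.2 (haar_sum nu.+1 c).
Proof.
under eq_bigr => p _ do rewrite block_haar_sum scaler_sumr.
rewrite exchange_big /= (bigD1 q) //= [X in _ + X]big1 => [|k nk].
  rewrite addr0; under eq_bigr => p _ do rewrite scalerA.
  by rewrite -scaler_suml g_dual eqxx scale1r.
under eq_bigr => p _ do rewrite scalerA.
by rewrite -scaler_suml g_dual eq_sym (negbTE nk) scale0r.
Qed.

(** Being centred, the [r q] with [q != 0] are killed by the conditional
expectation, which therefore truncates an expansion at [4 ^ nu]. *)
Lemma expectation_haar_sum nu c :
  \sum_i density1 alpha i i *: block i i (haar_sum nu.+1 c) = haar_sum nu c.
Proof.
under eq_bigr => i _ do rewrite block_haar_sum scaler_sumr.
rewrite exchange_big /= (bigD1 ord0) //= [X in _ + X]big1 => [|k nk].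
  rewrite addr0; under eq_bigr => p _ do rewrite scalerA.
  by rewrite -scaler_suml r_centred eqxx scale1r.
under eq_bigr => p _ do rewrite scalerA.
by rewrite -scaler_suml r_centred (negbTE nk) scale0r.
Qed.

Lemma layerE nu c q a b : q != ord0 ->
  layer nu c q a b = c (q * 4 ^ nu + shell0 a b)%N.
Proof.
move=> nq; rewrite /layer (negbTE nq) summxE.
have slt : (shell0 a b < 4 ^ nu)%N by rewrite (expnMn 2 2) shell0_lt.
rewrite (bigD1 (Ordinal slt)) //= !mxE -/(shell0 a b) eqxx mulr1 big1 ?addr0 //.
move=> k; rewrite !mxE -(inj_eq val_inj) /= -/(shell0 a b) eq_sym => /negbTE ->.
by rewrite mulr0.
Qed.

Lemma layer_trunc nu n c q : q != ord0 ->
  layer nu (trunc n c) q =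
  \matrix_(a, b) ((shell0 a b < n - q * 4 ^ nu)%N%:R * layer nu c q a b).
Proof.
move=> nq; apply/matrixP => a b; rewrite mxE !layerE // /trunc ltn_subRL.
by case: ifP => _; rewrite ?mul1r ?mul0r.
Qed.

Definition layer_norm s q : C :=
  \sum_(p : 'I_(2 ^ 1) * 'I_(2 ^ 1)) `|g q p.1 p.2| * (weight1 alpha s p.1 p.2)^-1.

Definition kron_norm s q : C := \sum_i \sum_j `|weight1 alpha s i j * r q i j|.

Definition basis_constant s : C :=
  1 + \sum_(q | q != ord0) kron_norm s q * (3 * layer_norm s q).

Lemma layer_norm_ge0 s q : 0 <= layer_norm s q.
Proof.
apply: sumr_ge0 => p _; rewrite mulr_ge0 // invr_ge0 ltW //.
exact: weight1_gt0.
Qed.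

Lemma kron_norm_ge0 s q : 0 <= kron_norm s q.
Proof. by apply: sumr_ge0 => i _; apply: sumr_ge0. Qed.

Lemma basis_constant_ge1 s : 1 <= basis_constant s.
Proof.
rewrite lerDl; apply: sumr_ge0 => q _.
by rewrite !mulr_ge0 ?layer_norm_ge0 ?kron_norm_ge0 ?ler0n.
Qed.

Lemma bounded_pairing_layer s nu c q K :
  bounded_pairing alpha s (haar_sum nu.+1 c) K ->
  bounded_pairing alpha s (layer nu c q) (layer_norm s q * K).
Proof.
move=> b; rewrite layer_dual /layer_norm big_distrl /=.
under [X in bounded_pairing _ _ _ X]eq_bigr => p _ do rewrite -mulrA.
by apply: bounded_pairing_sum => p _; exact: bounded_pairing_block.
Qed.

(** The constant does not deteriorate from level to level: the conditional
expectation and the inclusions are contractive, so that the induction hypothesis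
is used only for [n <= 4 ^ nu], and beyond it only the last level is cut. *)
Lemma bounded_pairing_trunc s nu n c K :
  bounded_pairing alpha s (haar_sum nu c) K ->
  bounded_pairing alpha s (haar_sum nu (trunc n c)) (basis_constant s * K).
Proof.
have wk nu' (x : N nu') K1 K2 : K1 <= K2 ->
    bounded_pairing alpha s x K1 -> bounded_pairing alpha s x K2.
  by move=> le b y cy; rewrite (le_trans (b _ cy)).
elim: nu => [|nu IH] in n c K * => b.
  have K0 := bounded_pairing_ge0 b.
  (* Level 0 has a single coefficient, which is kept or dropped. *)
  apply: (wk _ _ K); first by rewrite ler_peMl ?basis_constant_ge1.
  move: b; rewrite !haar_sum0 /trunc; case: ifP => // _ _ y _.
  by rewrite scale0r /pairing big1 ?normr0 // => i _; rewrite big1 // => j _;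
     rewrite mxE !mulr0.
have bE : bounded_pairing alpha s (haar_sum nu c) K.
  by rewrite -expectation_haar_sum; exact: bounded_pairing_expectation.
have K0 := bounded_pairing_ge0 b.
have split0 n' : haar_sum nu.+1 (trunc n' c) = incl (haar_sum nu (trunc n' c)) +
    \sum_(q | q != ord0) 1 *: kron (layer nu (trunc n' c) q) (r q).
  rewrite haar_sum_layers (bigD1 ord0) //= /layer eqxx r0; congr (_ + _).
  by apply: eq_bigr => q _; rewrite scale1r.
case: (leqP n (4 ^ nu)) => hn.
  rewrite split0 big1 => [|q nq].
    by rewrite addr0; apply: bounded_pairing_incl => //; exact: IH.
  rewrite scale1r layer_trunc //.
  suff -> : \matrix_(a, b0) ((shell0 a b0 < n - q * 4 ^ nu)%N%:R *
      layer nu c q a b0) = 0 by rewrite kron0l.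
  apply/matrixP => a b0; rewrite !mxE.
  have -> : (n - q * 4 ^ nu = 0)%N.
    apply/eqP; rewrite subn_eq0 (leq_trans hn) // leq_pmull //.
    by rewrite lt0n; apply: contra nq => /eqP q0; apply/eqP/val_inj.
  by rewrite ltn0 mul0r.
rewrite split0 /basis_constant mulrDl mul1r; apply: bounded_pairingD.
  apply: bounded_pairing_incl => //.
  have -> // : haar_sum nu (trunc n c) = haar_sum nu c.
  by apply: eq_bigr => j _; rewrite /trunc (ltn_trans _ hn).
rewrite big_distrl /=.
under [X in bounded_pairing _ _ _ X]eq_bigr => q _ do
  rewrite -[_ * K]mul1r -{1}(normr1 C).
apply: bounded_pairing_sum => q nq.
rewrite layer_trunc // -mulrA; apply: bounded_pairing_kron.
rewrite -mulrA; set K1 := layer_norm s q * K.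
have -> : 3 * K1 = K1 + K1 + K1 by ring.
by apply: bounded_pairing_shell; exact: bounded_pairing_layer.
Qed.

Lemma haar_span nu (X : N nu) : exists c, X = haar_sum nu c.
Proof.
elim: nu X => [|nu IH] X.
  exists (fun=> X ord0 ord0); rewrite haar_sum0.
  by apply/matrixP => a b; rewrite !ord1 !mxE mulr1.
pose L q : N nu := \sum_(p : 'I_(2 ^ 1) * 'I_(2 ^ 1))
                      g q p.1 p.2 *: block p.1 p.2 X.
have XL : X = \sum_q kron (L q) (r q).
  apply: pidx_mxP => a i b j; rewrite summxE.
  have := r_basis (\matrix_(i, j) X (pidx a i) (pidx b j)).
  move=> /matrixP/(_ i j); rewrite mxE => ->; rewrite summxE.
  apply: eq_bigr => q _; rewrite kronE mxE; congr (_ * _).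
  by rewrite summxE; apply: eq_bigr => p _; rewrite !mxE.
have [c0 e0] := IH (L ord0).
(* The coefficient of an entry is read off by inverting the injective [shell0]. *)
pose cq (q : 'I_4) (k : nat) : C :=
  \sum_(a < 2 ^ nu) \sum_(b < 2 ^ nu) (shell0 a b == k)%:R * L q a b.
exists (fun j => if (j < 4 ^ nu)%N then c0 j
                 else cq (inord (j %/ 4 ^ nu)%N) (j %% 4 ^ nu)%N).
rewrite haar_sum_layers [LHS]XL; apply: eq_bigr => q _; congr (kron _ _).
have [->|nq] := eqVneq q ord0.
  by rewrite e0 /layer eqxx; apply: eq_bigr => j _; rewrite ltn_ord.
apply/matrixP => a b; rewrite layerE //.
have slt : (shell0 a b < 4 ^ nu)%N by rewrite (expnMn 2 2) shell0_lt.
have q0 : (0 < q)%N.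
  by rewrite lt0n; apply: contra nq => /eqP q0; apply/eqP/val_inj.
rewrite ltnNge (leq_trans (leq_pmull _ q0) (leq_addr _ _)) /=.
rewrite divnMDl ?expn_gt0 // divn_small // addn0 modnMDl modn_small // inord_val.
rewrite /cq (bigD1 a) //= (bigD1 b) //= eqxx mul1r.
rewrite big1 => [|b' nb']; last first.
  case: eqP => [/shell0_inj[_ /val_inj eb]|_]; last by rewrite mul0r.
  by rewrite eb eqxx in nb'.
rewrite addr0 big1 ?addr0 // => a' na'; rewrite big1 // => b' _.
case: eqP => [/shell0_inj[/val_inj ea _]|_]; last by rewrite mul0r.
by rewrite ea eqxx in na'.
Qed.

(** By counting, every index below [4 ^ nu] is the shell index of an entry. *)
Lemma haar_neq0 nu j : (j < 4 ^ nu)%N -> haar r nu j != 0.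
Proof.
have r_neq0 q : r q != 0.
  apply/eqP => rq; have := g_dual q q; rewrite rq eqxx big1 => [|p _].
    by move/eqP; rewrite eq_sym oner_eq0.
  by rewrite mxE mulr0.
have kron_neq0 nu' (x : N nu') (y : N 1) : x != 0 -> y != 0 -> kron x y != 0.
  move=> /eqP x0 /eqP y0; apply/eqP => xy0; apply: x0; apply/matrixP => a b.
  apply/eqP; apply/negPn/negP => xab; apply: y0; apply/matrixP => i l.
  move/matrixP/(_ (pidx a i))/(_ (pidx b l)): xy0; rewrite kronE !mxE => /eqP.
  by rewrite mulf_eq0; move: xab; rewrite mxE => /negbTE -> /eqP.
have shell_neq0 nu' k : (k < 4 ^ nu')%N -> shell_unit R nu' k != 0.
  move=> hk; pose f (p : 'I_(2 ^ nu') * 'I_(2 ^ nu')) : 'I_(4 ^ nu') :=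
    Ordinal (leq_trans (shell0_lt (ltn_ord p.1) (ltn_ord p.2))
               (eq_leq (esym (expnMn 2 2 nu')))).
  have [f' _ f'K] : bijective f.
    apply: inj_card_bij; last by rewrite card_prod !card_ord (expnMn 2 2).
    by move=> [a b] [a' b'] [] /shell0_inj[/val_inj -> /val_inj ->].
  apply/eqP => /matrixP/(_ (f' (Ordinal hk)).1)/(_ (f' (Ordinal hk)).2).
  rewrite !mxE -/(shell0 _ _); have /(congr1 val)/= -> := f'K (Ordinal hk).
  by rewrite eqxx => /eqP; rewrite oner_eq0.
elim: nu j => [|nu IH] j hj; first by rewrite /= oner_neq0.
have e := divn_eq j (4 ^ nu).
have q4 : (j %/ 4 ^ nu < 4)%N by rewrite ltn_divLR ?expn_gt0 // -expnS.
have k4 : (j %% 4 ^ nu < 4 ^ nu)%N by rewrite ltn_mod expn_gt0.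
rewrite e (haar_rec (Ordinal q4) k4); apply: kron_neq0 => //.
by case: ifP => _; [exact: IH | exact: shell_neq0].
Qed.

End HaarPartialSums.

(** * Dual systems and defects of contractions *)

Section DualSystem.
Variables (R : realType) (alpha : R).
Notation N := (N R).
Variables (s : bool) (r : 'I_4 -> N 1).
Hypothesis r0 : r ord0 = 1%:M.
Hypothesis r_orthonormal :
  forall q k, pairing alpha s (adj_mx (r q)) (r k) = (q == k)%:R.

Definition dual_coef (q : 'I_4) (i j : 'I_(2 ^ 1)) : R[i] :=
  adj_mx (r q) j i * weight1 alpha s i j.

Lemma weight_level1 i j : weight alpha s i j = weight1 alpha s i j.
Proof. by rewrite /weight [density _ _]kron1l0. Qed.

Lemma dual_coefP q k :
  \sum_(p : 'I_(2 ^ 1) * 'I_(2 ^ 1)) dual_coef q p.1 p.2 * r k p.1 p.2 =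
  (q == k)%:R.
Proof.
rewrite -r_orthonormal /pairing pair_bigA /=; apply: eq_bigr => p _.
by rewrite weight_level1 mulrA.
Qed.

(** Four vectors with a dual family in dimension four form a basis: a right inverse
of a square matrix is a left inverse. *)
Lemma dual_coef_basis (u : N 1) :
  u = \sum_q (\sum_(p : 'I_(2 ^ 1) * 'I_(2 ^ 1))
                dual_coef q p.1 p.2 * u p.1 p.2) *: r q.
Proof.
pose unidx (m : 'I_4) : 'I_(2 ^ 1) * 'I_(2 ^ 1) := @mxtens_unindex (2 ^ 1) (2 ^ 1) m.
pose idx (p : 'I_(2 ^ 1) * 'I_(2 ^ 1)) : 'I_4 := mxtens_index p.
have sumE (F : 'I_(2 ^ 1) * 'I_(2 ^ 1) -> R[i]) :
    \sum_p F p = \sum_(m < 4) F (unidx m).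
  rewrite (reindex unidx) //; apply: onW_bij.
  by exists idx; [exact: mxtens_unindexK | exact: mxtens_indexK].
pose G : 'M[R[i]]_4 := \matrix_(q, m) dual_coef q (unidx m).1 (unidx m).2.
pose M : 'M[R[i]]_4 := \matrix_(m, k) r k (unidx m).1 (unidx m).2.
have /mulmx1C MG : G *m M = 1%:M.
  apply/matrixP => q k; rewrite !mxE -dual_coefP sumE.
  by apply: eq_bigr => m _; rewrite !mxE.
apply/matrixP => i j; rewrite summxE.
under eq_bigr => q _ do rewrite mxE big_distrl /=.
rewrite exchange_big /= (bigD1 (i, j)) //= [X in _ + X]big1 => [|p np].
  have := congr1 (fun A : 'M_4 => A (idx (i, j)) (idx (i, j))) MG.
  rewrite !mxE eqxx => e; rewrite addr0 -[LHS]mul1r -[1]e big_distrl /=.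
  apply: eq_bigr => q _; rewrite !mxE /unidx /idx mxtens_indexK /=; ring.
have := congr1 (fun A : 'M_4 => A (idx (i, j)) (idx p)) MG.
have nidx : (idx (i, j) == idx p) = false.
  apply/negbTE; apply: contra np => /eqP e.
  by apply/eqP/esym; exact: (can_inj (@mxtens_indexK (2 ^ 1) (2 ^ 1)) e).
rewrite !mxE nidx /idx => e.
rewrite -[RHS](mul0r (u p.1 p.2)) -[X in _ = X * _]e big_distrl /=.
apply: eq_bigr => q _; rewrite !mxE /unidx !mxtens_indexK /=; ring.
Qed.

Lemma orthonormal_centred q :
  \sum_i density1 alpha i i * r q i i = (q == ord0)%:R.
Proof.
have := r_orthonormal ord0 q; rewrite eq_sym => <-.
have -> : adj_mx (r ord0) = 1%:M by rewrite r0 /adj_mx trmx1 map_mx1.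
rewrite /pairing; apply: eq_bigr => i _; rewrite (bigD1 i) //=.
rewrite [1%:M i i]mxE eqxx mul1r weight_level1 weight1_diag big1 ?addr0 // => j nj.
by rewrite mxE (negbTE nj) mul0r.
Qed.

End DualSystem.

Section PositiveDefect.
Variable R : realType.
Notation C := R[i].

Local Notation ct a := (map_mx Num.conj a^T).

(** The matrix [1 - y^* y] is hermitian with nonnegative eigenvalues, and its square
root is taken in an orthonormal basis of eigenvectors. *)
Lemma contr_defect nu (y : N R nu) : contr y ->
  exists c : N R nu, adj_mx y *m y + adj_mx c *m c = 1%:M.
Proof.
move=> cy; pose A : 'M[C]_(2 ^ nu) := 1%:M - adj_mx y *m y.
have ctM m n p (a : 'M[C]_(m, n)) (b : 'M[C]_(n, p)) : ct (a *m b) = ct b *m ct a.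
  by rewrite trmx_mul map_mxM.
have ctK m n (a : 'M[C]_(m, n)) : ct (ct a) = a.
  by apply/matrixP => i j; rewrite !mxE conjCK.
have Aherm : A \is hermsymmx.
  apply/sesquilinear.is_hermitianmxP; rewrite expr0 scale1r /A.
  rewrite linearB /= map_mxB trmx1 map_mx1 /adj_mx ctM ctK //.
have /hermitian_normalmx/orthomx_spectralP := Aherm.
set P := spectralmx A; set D := spectral_diag A => AE.
have PU : P \is unitarymx by exact: spectral_unitarymx.
have PP := unitarymxP PU.
rewrite invmx_unitary // in AE.
have sqnE (v : 'cV[C]_(2 ^ nu)) : sqn v = (ct v *m v) 0 0.
  by rewrite mxE; apply: eq_bigr => a _; rewrite !mxE normCKC.
have D0 i : 0 <= D 0 i.
  pose v : 'cV[C]_(2 ^ nu) := col i (ct P).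
  have : 0 <= sqn v - sqn (y *m v) by rewrite subr_ge0.
  rewrite !sqnE ctM -mulmxA [_ *m (y *m v)]mulmxA.
  have -> (a b : 'M[C]_1) : a 0 0 - b 0 0 = (a - b) 0 0 by rewrite !mxE.
  rewrite -mulmxBr -[X in _ *m (X - _)]mul1mx -mulmxBl -/A AE.
  have -> : ct v = row i P.
    by apply/rowP => a; rewrite !mxE conjCK.
  have rP : row i P *m ct P = delta_mx 0 i by rewrite -row_mul PP row1.
  have Pv : P *m v = delta_mx i 0 by rewrite /v colE mulmxA PP mul1mx.
  by rewrite !mulmxA rP -mulmxA Pv -rowE -colE !mxE eqxx mulr1n.
pose S : 'M[C]_(2 ^ nu) := diag_mx (\row_i sqrtC (D 0 i)).
have SS : ct S *m S = diag_mx D.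
  apply/matrixP => i j; rewrite mul_mx_diag !mxE eq_sym; case: eqP => [->|_].
    by rewrite !mulr1n conj_Creal ?ger0_real ?sqrtC_ge0 // -expr2 sqrtCK.
  by rewrite !mulr0n rmorph0 mul0r.
exists (S *m P); apply/eqP; rewrite eq_sym addrC -subr_eq -/A; apply/eqP.
have -> : adj_mx (S *m P) = ct P *m ct S by exact: ctM.
by rewrite [LHS]AE mulmxA -(mulmxA _ _ S) SS.
Qed.

End PositiveDefect.

(** * Schauder bases from bounded partial sums *)

Section BoundedPartialSums.
Variable R : realType.
Notation C := R[i].

(** Limits are replaced by estimates along [(i.+1)^-1]; the conclusion includes that
[x] is real, the order of the complex numbers being partial. *)
Lemma ler0_small (K x : C) : 0 <= K ->
  (forall i : nat, x <= K * (i.+1%:R)^-1) -> x <= 0.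
Proof.
move=> K0 h; have xE : x = (complex.Re x)%:C.
  apply/eqP; rewrite eq_complex /= eqxx /=.
  by have := h 0%N; rewrite invr1 mulr1 lecE => /andP[/eqP <- _]; rewrite ger0_Im.
have KE : K = (complex.Re K)%:C by rewrite RRe_real // ger0_real.
rewrite xE lecR leNgt; apply/negP => x0.
set k := complex.Re K in KE; set y := complex.Re x in xE x0.
have [n hn] : exists n : nat, k / y < n%:R.
  exists (Num.bound `|k / y|); apply: le_lt_trans (ler_norm _) _.
  exact: archi_boundP.
have := h n; rewrite xE KE.
have -> : k%:C * (n.+1%:R)^-1 = (k / n.+1%:R)%:C.
  by rewrite rmorphM /= fmorphV /= rmorph_nat.
rewrite lecR ler_pdivlMr ?ltr0n // leNgt mulrC -ltr_pdivrMr //.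
by rewrite (lt_trans hn) // ltr_nat.
Qed.

Lemma normc_ge_Im (z : C) : `|complex.Im z|%:C <= `|z|.
Proof. by rewrite normc_def lecR -sqrtr_sqr ler_wsqrtr // lerDr sqr_ge0. Qed.

Lemma normc_le (x y : R) : `|(x +i* y)%C| <= `|x|%:C + `|y|%:C.
Proof.
have -> : (x +i* y)%C = x%:C + (0 +i* y)%C.
  by apply/eqP; rewrite eq_complex /= addr0 add0r !eqxx.
rewrite (le_trans (ler_normD _ _)) // lerD //.
  by rewrite normc_def /= expr0n addr0 sqrtr_sqr.
by rewrite normc_def /= expr0n add0r sqrtr_sqr.
Qed.

(** A form of completeness with an explicit rate, the suprema of [x i - e i] being
the limits of the real and imaginary parts. *)
Lemma complex_limit (a d : nat -> C) :
  (forall i j, `|a i - a j| <= d i + d j) ->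
  exists l, forall i, `|l - a i| <= 2 * d i.
Proof.
move=> h.
have d_ge0 i : 0 <= d i.
  by have := h i i; rewrite subrr normr0 -mulr2n pmulrn_lge0.
have real_limit (x : nat -> R) (e : nat -> R) :
    (forall i j, `|x i - x j| <= e i + e j) -> exists l, forall i, `|l - x i| <= e i.
  move=> hx; pose S := [set x i - e i | i in [set: nat]].
  have ubS j : ubound S (x j + e j).
    move=> _ [i _ <-]; rewrite lerBlDr -addrA -lerBlDl addrC.
    by rewrite (le_trans _ (hx i j)) // addrC ler_norm.
  exists (sup S) => i; rewrite ler_distl; apply/andP; split.
    apply: ub_le_sup; first by exists (x 0%N + e 0%N); exact: ubS.
    by exists i.
  by apply: ge_sup; [exists (x 0%N - e 0%N); exists 0%N | exact: ubS].
have dE i : d i = (complex.Re (d i))%:C by rewrite RRe_real // ger0_real.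
have [u hu] : exists u, forall i, `|u - complex.Re (a i)| <= complex.Re (d i).
  apply: real_limit => i j; rewrite -lecR rmorphD /= -!dE.
  rewrite (le_trans _ (h i j)) // -raddfB /=.
  exact: normc_ge_Re.
have [v hv] : exists v, forall i, `|v - complex.Im (a i)| <= complex.Re (d i).
  apply: real_limit => i j; rewrite -lecR rmorphD /= -!dE.
  rewrite (le_trans _ (h i j)) // -raddfB /=.
  exact: normc_ge_Im.
exists (u +i* v)%C => i.
case: (a i) (hu i) (hv i) => ai bi /= hui hvi.
apply: le_trans (_ : `|u - ai|%:C + `|v - bi|%:C <= _); first exact: normc_le.
by rewrite [d i]dE mulr_natl mulr2n lerD // lecR.
Qed.

Section Criterion.
Variables (B : completeNormedModType C) (e : nat -> B) (K : C).
Notation psum c n := (\sum_(0 <= k < n) c k *: e k).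
Hypothesis e_neq0 : forall k, e k != 0.
Hypothesis K_ge0 : 0 <= K.
Hypothesis psum_le : forall (c : nat -> C) n m, (n <= m)%N ->
  `|psum c n| <= K * `|psum c m|.
Hypothesis e_total : forall (b : B) (eps : C), 0 < eps ->
  exists c m, `|b - psum c m| < eps.

Lemma psumB (c c' : nat -> C) n :
  psum (fun k => c k - c' k) n = psum c n - psum c' n.
Proof. by rewrite -sumrB; apply: eq_bigr => k _; rewrite scalerBl. Qed.

Lemma psum_coef (c : nat -> C) k m : (k < m)%N ->
  `|c k| * `|e k| <= 2 * K * `|psum c m|.
Proof.
move=> km; rewrite -normrZ.
have -> : c k *: e k = psum c k.+1 - psum c k.
  by rewrite big_nat_recr //= [RHS]addrC addKr.
rewrite (le_trans (ler_normB _ _)) // -mulrA mulr_natl mulr2n.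
by rewrite lerD // psum_le // ltnW.
Qed.

(** The partial sums of the expansions of the approximants of [b] are uniformly
Cauchy, so that the coefficients converge and the sums can be exchanged. *)
Theorem schauder_basis_criterion : schauder_basis e.
Proof.
move=> b; pose d i : C := (i.+1%:R)^-1.
have d_gt0 i : 0 < d i by rewrite invr_gt0 ltr0n.
have /choice[cm cmP] i : exists p : (nat -> C) * nat, `|b - psum p.1 p.2| < d i.
  by have [c [m h]] := e_total b (d_gt0 i); exists (c, m).
pose a i k : C := if (k < (cm i).2)%N then (cm i).1 k else 0.
have aE i n : ((cm i).2 <= n)%N -> psum (a i) n = psum (cm i).1 (cm i).2.
  move=> h; rewrite (big_cat_nat (n := (cm i).2)) //= [X in _ + X]big1_seq.
    rewrite addr0; apply: eq_big_nat => k /andP[_ hk]; by rewrite /a hk.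
  move=> k; rewrite mem_index_iota => /andP[_ /andP[hk _]].
  by rewrite /a ltnNge hk scale0r.
have close i n : ((cm i).2 <= n)%N -> `|b - psum (a i) n| <= d i.
  by move=> h; rewrite aE // ltW.
have closeB i j n : `|psum (fun k => a i k - a j k) n| <= K * (d i + d j).
  pose m := maxn n (maxn (cm i).2 (cm j).2).
  apply: le_trans (psum_le _ (_ : n <= m)%N) _; first by rewrite leq_maxl.
  rewrite ler_wpM2l // psumB.
  have -> : psum (a i) m - psum (a j) m = (b - psum (a j) m) - (b - psum (a i) m).
    by rewrite [RHS]addrC opprB addrA subrK.
  rewrite (le_trans (ler_normB _ _)) // addrC lerD // close //.
    by rewrite /m !leq_max leqnn orbT.
  by rewrite /m !leq_max leqnn !orbT.
have en_gt0 k : 0 < `|e k| by rewrite normr_gt0.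
have /choice[c cP] k : exists l, forall i,
    `|l - a i k| <= 2 * (2 * K * K / `|e k| * d i).
  apply: complex_limit => i j; rewrite -mulrDr mulrAC ler_pdivlMr //.
  apply: le_trans (psum_coef (fun k => a i k - a j k) (ltnSn k)) _.
  by rewrite -!mulrA !ler_wpM2l // closeB.
have Sc i n : `|psum c n - psum (a i) n| <= K * d i.
  rewrite -psumB -subr_le0.
  pose L := \sum_(0 <= k < n) 2 * (2 * K * K / `|e k|) * `|e k| + K.
  have L0 : 0 <= L.
    rewrite addr_ge0 // sumr_ge0 // => k _.
    by rewrite !mulr_ge0 // ?invr_ge0.
  apply: (ler0_small L0) => j; rewrite -/(d j) lerBlDl mulrDl addrCA.
  have -> : psum (fun k => c k - a i k) n =
      psum (fun k => c k - a j k) n + psum (fun k => a j k - a i k) n.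
    by rewrite -big_split; apply: eq_bigr => k _ /=; rewrite -scalerDl addrA subrK.
  rewrite (le_trans (ler_normD _ _)) // lerD //; last first.
    by rewrite (le_trans (closeB _ _ _)) // mulrDr addrC.
  rewrite (le_trans (ler_norm_sum _ _ _)) // big_distrl /=; apply: ler_sum => k _.
  rewrite normrZ mulrAC ler_wpM2r //; have := cP k j.
  by rewrite mulrA.
have hc : series (fun k => c k *: e k) @ \oo --> b.
  apply/cvgrPdist_lt => eps eps0.
  have [i hi] : exists i, (1 + K) * d i < eps.
    apply/not_existsP => h; suff /le_gtF : eps <= 0 by rewrite eps0.
    have K1 : 0 <= 1 + K by rewrite addr_ge0.
    apply: (ler0_small K1) => i; have /negP := h i.
    by rewrite -real_leNgt ?ger0_real ?(ltW eps0) // mulr_ge0 // ltW.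
  exists (cm i).2 => // n /= hn; apply: le_lt_trans hi.
  have -> : b - series (fun k => c k *: e k) n =
      (b - psum (a i) n) - (psum c n - psum (a i) n).
    by rewrite opprB addrA subrK.
  rewrite (le_trans (ler_normB _ _)) // mulrDl mul1r lerD ?Sc //.
  exact: close.
exists c; split => //.
move=> c' hc'; apply: funext => k; apply/eqP; rewrite -subr_eq0 -normr_le0.
rewrite -(pmulr_lle0 _ (en_gt0 k)).
have K2 : 0 <= 2 * K by rewrite mulr_ge0.
apply: (ler0_small K2) => i; rewrite -/(d i).
have d2 : 0 < d i / 2 by rewrite divr_gt0.
have [n1 _ h1] : \forall n \near \oo, `|b - psum c n| < d i / 2.
  by move/cvgrPdist_lt : hc => /(_ _ d2).
have [n2 _ h2] : \forall n \near \oo, `|b - psum c' n| < d i / 2.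
  by move/cvgrPdist_lt : hc' => /(_ _ d2).
pose m := maxn k.+1 (maxn n1 n2).
apply: le_trans (psum_coef (fun k => c k - c' k) (_ : k < m)%N) _.
  by rewrite leq_maxl.
rewrite ler_wpM2l // psumB.
have -> : psum c m - psum c' m = (b - psum c' m) - (b - psum c m).
  by rewrite [RHS]addrC opprB addrA subrK.
rewrite (le_trans (ler_normB _ _)) // [d i]splitr lerD // ltW //.
  by apply: h2; rewrite /= /m !leq_max leqnn !orbT.
by apply: h1; rewrite /= /m !leq_max leqnn !orbT.
Qed.

End Criterion.

End BoundedPartialSums.

(** * Hilbert space preliminaries *)

Section HilbertSpaces.
Variables (R : realType) (H : hilbertType R).
Notation C := R[i].
Implicit Types u v w : H.

Lemma innerC u v : inner u v = Num.conj (inner v u).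
Proof. by rewrite hermC /= expr0 mul1r. Qed.

Lemma innerZr (c : C) u v : inner u (c *: v) = Num.conj c * inner u v.
Proof. exact: linearZr_LR. Qed.

Lemma innerZl (c : C) u v : inner (c *: u) v = c * inner u v.
Proof. exact: linearZl_LR. Qed.

Lemma innerDl u v w : inner (u + v) w = inner u w + inner v w.
Proof. exact: linearDl. Qed.

Lemma innerDr u v w : inner w (u + v) = inner w u + inner w v.
Proof. exact: linearDr. Qed.

Lemma innerBl u v w : inner (u - v) w = inner u w - inner v w.
Proof. exact: linearBl. Qed.

Lemma innerBr u v w : inner w (u - v) = inner w u - inner w v.
Proof. exact: linearBr. Qed.

Lemma inner_sumr (I : finType) (f : I -> H) u :
  inner u (\sum_k f k) = \sum_k inner u (f k).
Proof. exact: linear_sumr. Qed.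

Lemma inner_suml (I : finType) (f : I -> H) u :
  inner (\sum_k f k) u = \sum_k inner (f k) u.
Proof. exact: linear_sumlz. Qed.

Lemma norm2D u v (t := inner u v) :
  `|u + v| ^+ 2 = `|u| ^+ 2 + `|v| ^+ 2 + (t + Num.conj t).
Proof. by rewrite -!inner_norm innerDl !innerDr (innerC v u) -/t; ring. Qed.

Lemma bessel (I : finType) (e : I -> H) (d : C) v : 0 < d ->
  (forall p q, inner (e p) (e q) = (p == q)%:R * d) ->
  \sum_q `|inner v (e q)| ^+ 2 <= d * `|v| ^+ 2.
Proof.
move=> d0 he; pose w := \sum_q (inner v (e q) / d) *: e q.
have S0 : 0 <= `|v - w| ^+ 2 by rewrite exprn_ge0.
have dC : Num.conj d = d by rewrite conj_Creal // ger0_real // ltW.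
have vw : inner v w = (\sum_q `|inner v (e q)| ^+ 2) / d.
  rewrite inner_sumr big_distrl /=; apply: eq_bigr => q _.
  by rewrite innerZr rmorphM fmorphV /= dC normCK mulrAC [_ * inner v _]mulrC.
have ww : inner w w = (\sum_q `|inner v (e q)| ^+ 2) / d.
  rewrite -vw [in LHS]/w inner_suml [RHS]inner_sumr; apply: eq_bigr => p _.
  rewrite innerZl inner_sumr (bigD1 p) //= big1 => [|q nq].
    rewrite innerZr he eqxx mul1r addr0 innerZr rmorphM fmorphV /= dC.
    by field; rewrite gt_eqF.
  by rewrite innerZr he eq_sym (negbTE nq) mul0r mulr0.
set S := \sum_q _ in vw ww *.
have SR : Num.conj (S / d) = S / d.
  rewrite conj_Creal // ger0_real // divr_ge0 ?(ltW d0) //.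
  by rewrite /S; apply: sumr_ge0 => q _; rewrite exprn_ge0.
rewrite -inner_norm innerBl !innerBr (innerC w v) vw ww SR in S0.
rewrite subrr subr0 inner_norm subr_ge0 ler_pdivrMr // mulrC in S0.
by [].
Qed.

Lemma cauchy_schwarz u v : `|inner u v| <= `|u| * `|v|.
Proof.
have [->|v0] := eqVneq v 0; first by rewrite linear0r normr0 normr0 mulr0.
have v2 : 0 < `|v| ^+ 2 by rewrite exprn_gt0 // normr_gt0.
have := @bessel unit (fun=> v) (`|v| ^+ 2) u v2.
rewrite (big_pred1 tt) => [h|[]] //.
have {h} : `|inner u v| ^+ 2 <= (`|v| * `|u|) ^+ 2.
  by rewrite exprMn; apply: h => -[] []; rewrite eqxx mul1r inner_norm.
by rewrite ler_sqr ?nnegrE ?mulr_ge0 // mulrC.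
Qed.

End HilbertSpaces.

Section BoundedOperators.
Variable R : realType.
Notation C := R[i].

Lemma closureT_approx (V : normedModType C) (D : set V) :
  closure D = [set: V] ->
  forall v (eps : C), 0 < eps -> exists2 d, D d & `|v - d| < eps.
Proof.
move=> clD v eps e0; have : closure D v by rewrite clD.
move=> /(_ (ball v eps)) []; first exact: nbhsx_ballx.
by move=> d [Dd]; rewrite -ball_normE /= => h; exists d.
Qed.

Lemma bounded_opP (H : hilbertType R) (x : H -> H) : bounded_op x ->
  exists2 K : C, 0 <= K & forall v, `|x v| <= K * `|v|.
Proof.
move=> [xl xc]; have x0 : x 0 = 0 by have := xl (-1) 0 0; rewrite !scaleN1r !addNr.
have xZ c v : x (c *: v) = c *: x v by have := xl c v 0; rewrite x0 !addr0.
have /cvgrPdist_lt/(_ 1 ltr01) := xc 0; rewrite x0 => /nbhs_ballP[d /= d0 hd].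
exists (2 / d) => [|v]; first by rewrite divr_ge0 // ltW.
have [->|v0] := eqVneq v 0; first by rewrite x0 !normr0 mulr0.
have nv : 0 < `|v| by rewrite normr_gt0.
pose c := d / 2 / `|v|; have c0 : 0 < c by rewrite !divr_gt0.
have : ball 0 d (c *: v).
  rewrite -ball_normE /= sub0r normrN normrZ gtr0_norm // /c divfK ?gt_eqF //.
  by rewrite ltr_pdivrMr // ltr_pMr // ltr1n.
move/hd; rewrite sub0r normrN xZ normrZ (gtr0_norm c0) -ltr_pdivlMl //.
by rewrite mulr1 /c !invf_div mulrC [_ / _ * _]mulrC mulrA => /ltW.
Qed.

Lemma bounded_opI (H : hilbertType R) (x : H -> H) (K : C) : 0 <= K ->
  linear x -> (forall v, `|x v| <= K * `|v|) -> bounded_op x.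
Proof.
move=> K0 xl xK; split => // v; apply/cvgrPdist_lt => eps e0.
have K1 : 0 < K + 1 by rewrite ltr_wpDl.
apply/nbhs_ballP; exists (eps / (K + 1)); first by rewrite /= divr_gt0.
move=> w; rewrite -ball_normE /= => vw.
have -> : x v - x w = x (v - w).
  by rewrite addrC -scaleN1r -xl scaleN1r addrC.
rewrite (le_lt_trans (xK _)) //.
rewrite ltr_pdivlMr // mulrC in vw; apply: le_lt_trans vw.
by rewrite ler_wpM2r // lerDl.
Qed.

Lemma bounded_op_ext (H : hilbertType R) (x y : H -> H) (D : set H) :
  bounded_op x -> bounded_op y -> closure D = [set: H] ->
  (forall d, D d -> x d = y d) -> x = y.
Proof.
move=> bx by_ clD e; apply: funext => v; apply/eqP; rewrite -subr_eq0 -normr_le0.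
have [K K0 hK] := bounded_opP bx; have [L L0 hL] := bounded_opP by_.
have KL : 0 <= K + L by rewrite addr_ge0.
apply: (ler0_small KL) => i.
have i0 : 0 < (i.+1%:R : C)^-1 by rewrite invr_gt0 ltr0n.
have [d Dd hd] := closureT_approx clD v i0.
have lB (z : H -> H) : linear z -> forall u w, z (u - w) = z u - z w.
  by move=> zl u w; rewrite addrC -scaleN1r zl scaleN1r addrC.
have -> : x v - y v = x (v - d) - y (v - d).
  by rewrite (lB _ bx.1) (lB _ by_.1) (e _ Dd) opprB addrA subrK.
rewrite (le_trans (ler_normB _ _)) // mulrDl lerD //.
  by rewrite (le_trans (hK _)) // ler_wpM2l // ltW.
by rewrite (le_trans (hL _)) // ler_wpM2l // ltW.
Qed.

Lemma complete_limit (B : completeNormedModType C) (s : nat -> B) (K : C) :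
  0 <= K -> (forall i j, `|s i - s j| <= K * ((i.+1%:R)^-1 + (j.+1%:R)^-1)) ->
  exists l, forall i, `|l - s i| <= K * (i.+1%:R)^-1.
Proof.
move=> K0 h.
have small (eps : C) : 0 < eps -> exists N, forall i, (N <= i)%N -> K * (i.+1%:R)^-1 < eps.
  move=> e0; have [N hN] : exists N : nat, K * (N.+1%:R)^-1 < eps.
    apply/not_existsP => hN; suff /le_gtF : eps <= 0 by rewrite e0.
    apply: (ler0_small K0) => i; have /negP := hN i.
    by rewrite -real_leNgt ?ger0_real ?(ltW e0) // mulr_ge0 // invr_ge0.
  exists N => i Ni; apply: le_lt_trans hN.
  by rewrite ler_wpM2l // lef_pV2 ?posrE ?ltr0n // ler_nat.
have /cauchy_cvgP/cvg_ex[l sl] : cauchy (s @ \oo).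
  apply: cauchy_exP => eps e0.
  have e2 : 0 < eps / 2 by rewrite divr_gt0.
  have [N hN] := small _ e2.
  exists (s N); exists N => // i /= Ni; rewrite -ball_normE /=.
  rewrite (le_lt_trans (h _ _)) // mulrDr [eps]splitr ltrD ?hN //.
exists l => i; rewrite -subr_le0.
apply: (@ler0_small _ 1) => // j; rewrite mul1r.
have e2 : 0 < (j.+1%:R : C)^-1 / 2 by rewrite divr_gt0 // invr_gt0 ltr0n.
have [N hN] := small _ e2.
have [M _ hM] : \forall n \near \oo, `|l - s n| < (j.+1%:R : C)^-1 / 2.
  by move/cvgrPdist_lt : sl => /(_ _ e2).
pose n := maxn N M; rewrite lerBlDl.
have -> : l - s i = (l - s n) + (s n - s i) by rewrite addrA subrK.
rewrite (le_trans (ler_normD _ _)) //.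
rewrite (le_trans (lerD (ltW (hM n _)) (h n i))) //= ?leq_maxr //.
rewrite mulrDr addrA addrC lerD // [leRHS]splitr lerD // ltW //.
by rewrite hN // leq_maxl.
Qed.

(** Extension by continuity: [T a] depends on the vector [J a] only and extends
to a bounded operator as soon as it is dominated by it on a dense range. *)
Lemma dense_extension (H : hilbertType R) (A : lmodType C) (J T : A -> H) (K : C) :
  0 <= K -> linear J -> linear T -> closure (range J) = [set: H] ->
  (forall a, `|T a| <= K * `|J a|) ->
  exists2 X : H -> H, bounded_op X & forall a, X (J a) = T a.
Proof.
move=> K0 Jl Tl clJ TK.
have lB (z : A -> H) : linear z -> forall u w, z (u - w) = z u - z w.
  by move=> zl u w; rewrite addrC -scaleN1r zl scaleN1r addrC.
have d0 (i : nat) : 0 < (i.+1%:R : C)^-1 by rewrite invr_gt0 ltr0n.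
have /choice[X hX] v : exists l, forall a, `|l - T a| <= K * `|v - J a|.
  have /choice[a ha] i : exists a, `|v - J a| < (i.+1%:R : C)^-1.
    by have [_ [a _ <-] h] := closureT_approx clJ v (d0 i); exists a.
  have [|l hl] := @complete_limit H (fun i => T (a i)) K K0.
    move=> i j; rewrite -(lB _ Tl) (le_trans (TK _)) // ler_wpM2l // (lB _ Jl).
    have -> : J (a i) - J (a j) = (v - J (a j)) - (v - J (a i)).
      by rewrite [RHS]addrC opprB addrA subrK.
    by rewrite (le_trans (ler_normB _ _)) // addrC lerD // ltW.
  exists l => b; rewrite -subr_le0.
  have K2 : 0 <= K + K by rewrite addr_ge0.
  apply: (ler0_small K2) => i; rewrite lerBlDl.
  have -> : l - T b = (l - T (a i)) + (T (a i) - T b) by rewrite addrA subrK.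
  rewrite (le_trans (ler_normD _ _)) // mulrDl addrCA lerD ?hl // -mulrDr.
  rewrite -(lB _ Tl) (le_trans (TK _)) // ler_wpM2l // (lB _ Jl).
  have -> : J (a i) - J b = (v - J b) - (v - J (a i)).
    by rewrite [RHS]addrC opprB addrA subrK.
  by rewrite (le_trans (ler_normB _ _)) // lerD // ltW.
have XJ a : X (J a) = T a.
  by apply/eqP; rewrite -subr_eq0 -normr_le0 (le_trans (hX _ a)) // subrr normr0 mulr0.
exists X => //; apply: (@bounded_opI _ _ K) => // [c u v|v].
  apply/eqP; rewrite -subr_eq0 -normr_le0.
  have L0 : 0 <= 2 * K * (`|c| + 1) by rewrite !mulr_ge0 // addr_ge0.
  apply: (ler0_small L0) => i.
  have [_ [a _ <-] ha] := closureT_approx clJ u (d0 i).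
  have [_ [b _ <-] hb] := closureT_approx clJ v (d0 i).
  have -> : X (c *: u + v) - (c *: X u + X v) =
    (X (c *: u + v) - T (c *: a + b)) - (c *: (X u - T a) + (X v - T b)).
    by rewrite Tl scalerBr [c *: X u - _ + _]addrACA -opprD opprB addrA subrK.
  have bd : `|c *: (u - J a) + (v - J b)| <= (`|c| + 1) * (i.+1%:R)^-1.
    rewrite (le_trans (ler_normD _ _)) // normrZ mulrDl mul1r.
    by rewrite lerD // ?ler_wpM2l // ltW.
  rewrite (le_trans (ler_normB _ _)) // -!mulrA mulr_natl mulr2n lerD //.
    rewrite (le_trans (hX _ _)) // ler_wpM2l //.
    by rewrite Jl opprD addrACA -scalerBr.
  rewrite (le_trans (ler_normD _ _)) // normrZ.
  rewrite (le_trans (lerD (ler_wpM2l (normr_ge0 _) (hX _ a)) (hX _ b))) //.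
  rewrite mulrCA -mulrDr ler_wpM2l // mulrDl mul1r.
  by rewrite lerD // ?ler_wpM2l // ltW.
have J0 : J 0 = 0 by have := Jl (-1) 0 0; rewrite !scaleN1r !addNr.
have T0 : T 0 = 0 by have := Tl (-1) 0 0; rewrite !scaleN1r !addNr.
by have := hX v 0; rewrite J0 T0 !subr0.
Qed.

End BoundedOperators.

(** A vector almost minimising [|w| ^+ 2 - 2 Re (f w)] almost represents [f]:
moving it in the direction of [v] gains the square of the defect at [v]. *)
Lemma approximate_riesz (R : realType) (H : hilbertType R) (f : H -> R[i])
    (K eps : R[i]) : scalar f -> 0 <= K -> (forall v, `|f v| <= K * `|v|) ->
  0 < eps -> exists w, forall v, `|f v - inner v w| <= eps * `|v|.
Proof.
move=> fl K0 fK e0.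
have f0 : f 0 = 0 by have := fl (-1) 0 0; rewrite scaleN1r addNr mulN1r addNr.
pose Jc w : R[i] := `|w| ^+ 2 - (f w + Num.conj (f w)).
have reJ (z : R[i]) : z + Num.conj z \is Num.real.
  by rewrite CrealE rmorphD /= conjCK addrC.
have JcR w : (complex.Re (Jc w))%:C = Jc w.
  by rewrite RRe_real // /Jc rpredB ?reJ // ger0_real // exprn_ge0.
pose J w := complex.Re (Jc w).
have lbJ w : - (complex.Re K) ^+ 2 <= J w.
  rewrite -lecR JcR rmorphN rmorphXn /= RRe_real ?ger0_real // /Jc lerNl opprB.
  have fle : f w + Num.conj (f w) <= 2 * (K * `|w|).
    apply: le_trans (real_ler_norm (reJ _)) _.
    by rewrite (le_trans (ler_normD _ _)) // norm_conjC mulr_natl mulr2n lerD.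
  rewrite lerBlDr (le_trans fle) // -subr_ge0.
  have -> : K ^+ 2 + `|w| ^+ 2 - 2 * (K * `|w|) = (K - `|w|) ^+ 2 by ring.
  by rewrite real_exprn_even_ge0 // rpredB ?ger0_real.
have hinf : has_inf [set J w | w in [set: H]].
  by split; [exists (J 0); exists 0 | exists (- (complex.Re K) ^+ 2) => _ [w _ <-]].
have e2 : 0 < (complex.Re eps) ^+ 2.
  by rewrite exprn_gt0 // -ltcR RRe_real ?gtr0_real.
have [_ [w _ <-] hw] := inf_adherent e2 hinf.
exists w => v; have [->|v0] := eqVneq v 0.
  by rewrite f0 linear0l subrr !normr0 mulr0.
have nv : 0 < `|v| by rewrite normr_gt0.
set g := f v - inner v w.
(* The minimum over [t] of the variation along [t *: v] is attained here. *)
pose t := Num.conj g / `|v| ^+ 2.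
have tg : t * g = `|g| ^+ 2 / `|v| ^+ 2 by rewrite /t mulrAC -normCKC.
have tgR : Num.conj (t * g) = t * g.
  by rewrite tg conj_Creal // ger0_real // divr_ge0 // exprn_ge0.
have tt : `|t *: v| ^+ 2 = t * g.
  rewrite normrZ exprMn tg /t normrM norm_conjC normfV normrX normr_id.
  by field; rewrite gt_eqF.
have step : Jc (w + t *: v) = Jc w - t * g.
  rewrite /Jc norm2D tt (innerC w) conjCK innerZl.
  have -> : f (w + t *: v) = f w + t * f v by rewrite addrC fl addrC.
  have -> : t * f v = t * g + t * inner v w by rewrite -mulrDr /g subrK.
  by rewrite !rmorphD /= tgR; ring.
have : J w - complex.Re eps ^+ 2 < J (w + t *: v).
  rewrite ltrBlDr (lt_le_trans hw) // lerD2r.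
  by apply: ge_inf; [case: hinf | exists (w + t *: v)].
rewrite -ltcR rmorphB rmorphXn /= !JcR RRe_real ?gtr0_real // step.
rewrite ltrD2l ltrN2 tg ltr_pdivrMr ?exprn_gt0 // -exprMn => /ltW.
by rewrite ler_sqr ?nnegrE // mulr_ge0 // ltW.
Qed.

(** * The conditional expectation onto a level *)

Section PowersFactor.
Variables (R : realType) (alpha : R).
Hypothesis halpha : 0 < alpha < 1.
Notation C := R[i].
Notation N := (N R).
Variables (A : cstarAlgType R) (iota : forall nu, N nu -> A).
Hypothesis hA : is_inductive_limit iota.
Variable phi : A -> C.
Hypothesis hphi : is_state phi.
Hypothesis hind : forall nu, (0 < nu)%N ->
  forall x : N nu, phi (iota x) = rho alpha x.
Variables (H : hilbertType R) (Pi : A -> H -> H) (Omega : H).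
Hypothesis hGNS : is_gns phi Pi Omega.

Local Notation M := (vn_generated (range Pi)).
Local Notation pi x := (Pi (iota x)).
Local Notation d a := (density alpha _ a a).

Lemma gnsM a b v : Pi (cmul a b) v = Pi a (Pi b v).
Proof. by rewrite (gns_mul hGNS). Qed.

Lemma gnsl c a b v : Pi (c *: a + b) v = c *: Pi a v + Pi b v.
Proof. by rewrite (gns_linear hGNS). Qed.

Lemma gns_inner a b u v : inner (Pi a u) (Pi b v) = inner (Pi (cmul (star b) a) u) v.
Proof. by rewrite gnsM [RHS](gns_star hGNS) starK. Qed.

Lemma gns_phi a b : inner (Pi a Omega) (Pi b Omega) = phi (cmul (star b) a).
Proof. by rewrite gns_inner (gns_state hGNS). Qed.

Lemma gns_norm a : `|Pi a Omega| <= `|a|.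
Proof.
rewrite -ler_sqr ?nnegrE // -inner_norm gns_phi -(cstar_identity a).
by rewrite (le_trans (real_ler_norm _)) ?(state_le_norm hphi) //
  ger0_real // (state_positive hphi).
Qed.

Lemma norm_Omega : `|Omega| = 1.
Proof.
apply/eqP; rewrite -(@eqrXn2 _ 2) // expr1n -inner_norm.
have := gns_state hGNS cone; rewrite (gns_one hGNS) (state1 hphi) => <-.
by [].
Qed.

Lemma pi_approx v (eps : C) : 0 < eps ->
  exists nu (z : N nu), (0 < nu)%N /\ `|v - pi z Omega| < eps.
Proof.
move=> e0; have e2 : 0 < eps / 2 by rewrite divr_gt0.
have [_ [a _ <-] ha] := closureT_approx (gns_cyclic hGNS) v e2.
have [_ [nu /= nu0 [z _ <-]] hz] := closureT_approx (limit_dense hA) a e2.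
exists nu, z; split=> //.
have -> : v - pi z Omega = (v - Pi a Omega) + (Pi a Omega - pi z Omega).
  by rewrite addrA subrK.
rewrite (le_lt_trans (ler_normD _ _)) // [eps]splitr ltrD //.
apply: le_lt_trans hz.
have -> : Pi a Omega - pi z Omega = Pi (a - iota z) Omega.
  by rewrite [LHS]addrC -scaleN1r -gnsl scaleN1r [- _ + _]addrC.
exact: gns_norm.
Qed.

(** Elements of different levels are compared inside a common one; the second
clause carries the hypothesis of the KMS relation along. *)
Lemma level_embedding nu mu : (0 < nu)%N -> (nu <= mu)%N -> exists f : N nu -> N mu,
  (forall z, iota (f z) = iota z) /\
  (forall a b, a *m density alpha nu = density alpha nu *m b ->
     f a *m density alpha mu = density alpha mu *m f b).
Proof.
move=> nu0 /subnK <-; elim: (mu - nu)%N => [|k [f [fi fA]]]; first by exists id.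
exists (fun z => incl (f z)); split => [z|a b /fA e].
  by rewrite (limit_compat hA) ?fi // addn_gt0 nu0 orbT.
by rewrite /incl /= !kron_mulmx mulmx1 mul1mx e.
Qed.

(** The KMS relation is the cyclicity of the trace when [x] is a matrix of some
level, and extends to the limit by continuity. *)
Lemma state_kms nu (a b : N nu) (x : A) : (0 < nu)%N ->
  a *m density alpha nu = density alpha nu *m b ->
  phi (cmul x (iota a)) = phi (cmul (iota b) x).
Proof.
move=> nu0 e; apply/eqP; rewrite -subr_eq0 -normr_le0.
pose K := `|iota a| + `|iota b|; have K0 : 0 <= K by rewrite addr_ge0.
apply: (ler0_small K0) => i.
have i0 : 0 < (i.+1%:R : C)^-1 by rewrite invr_gt0 ltr0n.
have [_ [mu /= mu0 [z _ <-]] hz] := closureT_approx (limit_dense hA) x i0.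
have zE : phi (cmul (iota z) (iota a)) = phi (cmul (iota b) (iota z)).
  (* Both elements are moved to a common level. *)
  have [f [fi fA]] := @level_embedding nu (maxn nu mu) nu0 (leq_maxl _ _).
  have [g [gi _]] := @level_embedding mu (maxn nu mu) mu0 (leq_maxr _ _).
  have m0 : (0 < maxn nu mu)%N by rewrite leq_max nu0.
  rewrite -fi -(fi b) -gi -!(limit_mul hA) // !hind // /rho.
  by rewrite -mulmxA (fA _ _ e) mulmxA mxtrace_mulC mulmxA.
have phiB u v : phi (u - v) = phi u - phi v.
  by rewrite addrC -scaleN1r (state_linear hphi) mulN1r addrC.
have -> : phi (cmul x (iota a)) - phi (cmul (iota b) x) =
  phi (cmul (x - iota z) (iota a)) - phi (cmul (iota b) (x - iota z)).
  have -> : cmul (x - iota z) (iota a) = cmul x (iota a) - cmul (iota z) (iota a).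
    by rewrite addrC -scaleN1r cmul_linearl scaleN1r addrC.
  have -> : cmul (iota b) (x - iota z) = cmul (iota b) x - cmul (iota b) (iota z).
    by rewrite addrC -scaleN1r cmul_linearr scaleN1r addrC.
  by rewrite !phiB zE opprB addrA subrK.
rewrite (le_trans (ler_normB _ _)) // mulrDl; apply: lerD.
  rewrite (le_trans (state_le_norm hphi _)) // (le_trans (cnormM _ _)) //.
  by rewrite mulrC ler_wpM2l // ltW.
rewrite (le_trans (state_le_norm hphi _)) // (le_trans (cnormM _ _)) //.
by rewrite ler_wpM2l // ltW.
Qed.

Section Level.
Variable nu : nat.
Hypothesis nu0 : (0 < nu)%N.
Local Notation E := (fun q s : 'I_(2 ^ nu) => iota (delta_mx q s : N nu)).
Local Notation "'dd' q" := (density alpha nu q q) (at level 10).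

Lemma delta_density q s : (delta_mx q s : N nu) *m density alpha nu =
  density alpha nu *m ((dd s / dd q) *: delta_mx q s).
Proof.
have dq := gt_eqF (density_gt0 halpha q).
have DE : density alpha nu = diag_mx (\row_a dd a).
  apply/matrixP => a b; rewrite !mxE; have [->|nab] := eqVneq a b.
    by rewrite mulr1n.
  by rewrite density_diag // mulr0n.
rewrite {1 2}DE mul_mx_diag mul_diag_mx; apply/matrixP => a b; rewrite !mxE.
have [->|_] := eqVneq a q; have [->|_] := eqVneq b s;
  rewrite /= ?mul0r ?mulr0 //.
by rewrite mul1r mulr1 mulrC divfK ?dq.
Qed.

Lemma iotaZ c (x : N nu) : iota (c *: x) = c *: iota x.
Proof.
have l := limit_linear hA nu0.
have i0 : @iota nu 0 = 0 by have := l (-1) 0 0; rewrite !scaleN1r !addNr.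
by have := l c x 0; rewrite i0 !addr0.
Qed.

Lemma cmulZl c (x y : A) : cmul (c *: x) y = c *: cmul x y.
Proof.
have c0 : cmul 0 y = 0 by have := cmul_linearl y (-1) 0 0; rewrite !scaleN1r !addNr.
by have := cmul_linearl y c x 0; rewrite c0 !addr0.
Qed.

Lemma phiZ c x : phi (c *: x) = c * phi x.
Proof.
have p0 : phi 0 = 0 by have := state_linear hphi (-1) 0 0; rewrite !scaleN1r !addNr mulN1r addNr.
by have := state_linear hphi c x 0; rewrite p0 !addr0.
Qed.

Lemma kms_delta q s x : phi (cmul x (E q s)) = dd s / dd q * phi (cmul (E q s) x).
Proof. by rewrite (state_kms x nu0 (delta_density q s)) iotaZ cmulZl phiZ. Qed.

Lemma E_mul p q s : cmul (E p q) (E q s) = E p s.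
Proof. by rewrite -(limit_mul hA) // mul_delta_mx. Qed.

Lemma E_star p q : star (E p q) = E q p.
Proof.
rewrite -(limit_star hA) // /adj_mx trmx_delta; congr iota.
by apply/matrixP => a b; rewrite !mxE rmorph_nat.
Qed.

(** Right multiplication by a matrix unit is bounded, because in the state it
can be moved to the left. *)
Lemma right_mult_bound q s a :
  `|Pi a (Pi (E q s) Omega)| ^+ 2 <= dd s / dd q * `|Pi a Omega| ^+ 2.
Proof.
pose t p := phi (cmul (E p p) (cmul (star a) a)).
have tE p s' : `|Pi a (Pi (E p s') Omega)| ^+ 2 = dd s' / dd p * t p.
  rewrite -inner_norm -gnsM gns_phi starM E_star.
  rewrite -cmulA [cmul (star a) _]cmulA cmulA kms_delta cmulA E_mul //.
have t0 p : 0 <= t p.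
  have := tE p p; rewrite divff ?gt_eqF ?density_gt0 // mul1r => <-.
  by rewrite exprn_ge0.
have tS : `|Pi a Omega| ^+ 2 = \sum_p t p.
  rewrite -inner_norm gns_phi.
  have phis (f : 'I_(2 ^ nu) -> A) : phi (\sum_p f p) = \sum_p phi (f p).
    apply: (big_morph phi) => [u v|].
      by have := state_linear hphi 1 u v; rewrite !scale1r mul1r.
    by have := phiZ 0 0; rewrite scale0r mul0r.
  have cs (f : 'I_(2 ^ nu) -> A) y : cmul (\sum_p f p) y = \sum_p cmul (f p) y.
    apply: (big_morph (cmul ^~ y)) => [u v|].
      by have := cmul_linearl y 1 u v; rewrite !scale1r.
    by have := cmulZl 0 0 y; rewrite !scale0r.
  have is_ (f : 'I_(2 ^ nu) -> N nu) : iota (\sum_p f p) = \sum_p iota (f p).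
    apply: (big_morph (@iota nu)) => [u v|].
      by have := limit_linear hA nu0 1 u v; rewrite !scale1r.
    by have := iotaZ 0 0; rewrite !scale0r.
  rewrite -phis -cs -is_.
  have -> : \sum_p delta_mx p p = 1%:M :> N nu by rewrite -mx1_sum_delta.
  by rewrite (limit_one hA) // cmul1x.
have dd0 : 0 <= dd s / dd q by rewrite divr_ge0 // ltW // density_gt0.
by rewrite tE ler_wpM2l // tS (bigD1 q) //= lerDl sumr_ge0.
Qed.

Lemma right_multiplication q s : exists2 X, commutant (range Pi) X &
  X Omega = Pi (E q s) Omega.
Proof.
pose K := sqrtC (dd s / dd q).
have dd0 : 0 <= dd s / dd q by rewrite divr_ge0 // ltW // density_gt0.
have [|||||X bX XE] := @dense_extension R H A (fun a => Pi a Omega)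
    (fun a => Pi a (Pi (E q s) Omega)) K.
- by rewrite sqrtC_ge0.
- by move=> c a b; rewrite gnsl.
- by move=> c a b; rewrite gnsl.
- exact: gns_cyclic hGNS.
- move=> a; rewrite -ler_sqr ?nnegrE ?mulr_ge0 ?sqrtC_ge0 // exprMn sqrtCK.
  exact: right_mult_bound.
have XO : X Omega = Pi (E q s) Omega.
  by have := XE cone; rewrite (gns_one hGNS).
exists X => //; split=> // _ [b _ <-]; apply/esym.
have comp (x y : H -> H) : bounded_op x -> bounded_op y -> bounded_op (x \o y).
  move=> [xl xc] [yl yc]; split => [c u v|v] /=; first by rewrite yl xl.
  exact: (continuous_comp (yc v) (xc _)).
apply: (bounded_op_ext _ _ (gns_cyclic hGNS)).
- by apply: comp => //; exact: gns_bounded hGNS b.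
- by apply: comp => //; exact: gns_bounded hGNS b.
- by move=> _ [a _ <-] /=; rewrite XE -!gnsM XE !gnsM.
Qed.

(** Elements of the von Neumann algebra commute with right multiplications, so
that the KMS relation persists for them. *)
Lemma vn_kms y w q s : M y -> inner (y (Pi w (Pi (E q s) Omega))) Omega =
  dd s / dd q * inner (y (Pi w Omega)) (Pi (E s q) Omega).
Proof.
move=> [by_ yc]; have [X cX XO] := right_multiplication q s.
have Xb := cX.1; have XPi a v : X (Pi a v) = Pi a (X v).
  by have := congr1 (@^~ v) (cX.2 (Pi a) (ex_intro2 _ _ a I erefl)).
rewrite -XO -XPi; have := congr1 (@^~ (Pi w Omega)) (yc _ cX) => /= ->.
move: (y _) => f; apply/eqP; rewrite -subr_eq0 -normr_le0.
set c := dd s / dd q.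
have [K K0 hK] := bounded_opP Xb.
pose L := K + `|c| * `|Pi (E s q) Omega|.
have L0 : 0 <= L by rewrite addr_ge0 // mulr_ge0.
apply: (ler0_small L0) => i.
have i0 : 0 < (i.+1%:R : C)^-1 by rewrite invr_gt0 ltr0n.
have [_ [a _ <-] ha] := closureT_approx (gns_cyclic hGNS) f i0.
have aE : inner (X (Pi a Omega)) Omega = c * inner (Pi a Omega) (Pi (E s q) Omega).
  rewrite XPi XO -gnsM -(gns_state hGNS) kms_delta gns_phi E_star //.
have -> : inner (X f) Omega - c * inner f (Pi (E s q) Omega) =
  inner (X (f - Pi a Omega)) Omega - c * inner (f - Pi a Omega) (Pi (E s q) Omega).
  have -> : X (f - Pi a Omega) = X f - X (Pi a Omega).
    by rewrite addrC -scaleN1r Xb.1 scaleN1r addrC.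
  by rewrite !innerBl mulrBr aE opprB addrA subrK.
rewrite (le_trans (ler_normB _ _)) // mulrDl; apply: lerD.
  rewrite (le_trans (cauchy_schwarz _ _)) // norm_Omega mulr1.
  by rewrite (le_trans (hK _)) // ler_wpM2l // ltW.
rewrite normrM -mulrA ler_wpM2l // (le_trans (cauchy_schwarz _ _)) // mulrC.
by rewrite ler_wpM2l // ltW.
Qed.

Lemma gnsZ c a v : Pi (c *: a) v = c *: Pi a v.
Proof.
have P0 : Pi 0 v = 0 by have := gnsl (-1) 0 0 v; rewrite !scaleN1r !addNr.
by have := gnsl c a 0 v; rewrite P0 !addr0.
Qed.

Lemma iotaD (x y : N nu) : iota (x + y) = iota x + iota y.
Proof. by have := limit_linear hA nu0 1 x y; rewrite !scale1r. Qed.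

Lemma gnsD a b v : Pi (a + b) v = Pi a v + Pi b v.
Proof. by have := gnsl 1 a b v; rewrite !scale1r. Qed.

Lemma pi_entries (z : N nu) v :
  pi z v = \sum_p \sum_q z p q *: Pi (E p q) v.
Proof.
pose F (x : N nu) := pi x v.
have FD : {morph F : x y / x + y} by move=> x y; rewrite /F iotaD gnsD.
have F0 : F 0 = 0.
  by have := FD 0 0; rewrite addr0 => /eqP; rewrite addrC -subr_eq subrr => /eqP.
rewrite -/(F z) [in LHS](matrix_sum_delta z) (big_morph F FD F0).
apply: eq_bigr => p _; rewrite (big_morph F FD F0); apply: eq_bigr => q _.
by rewrite /F iotaZ gnsZ.
Qed.

Lemma bounded_op_sum (y : H -> H) (I : finType) (f : I -> H) : bounded_op y ->
  y (\sum_k f k) = \sum_k y (f k).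
Proof.
move=> [yl _]; apply: (big_morph y) => [u v|].
  by have := yl 1 u v; rewrite !scale1r.
by have := yl (-1) 0 0; rewrite !scaleN1r !addNr.
Qed.

Lemma bounded_opZ (y : H -> H) c v : bounded_op y -> y (c *: v) = c *: y v.
Proof.
move=> [yl _]; have y0 : y 0 = 0 by have := yl (-1) 0 0; rewrite !scaleN1r !addNr.
by have := yl c v 0; rewrite y0 !addr0.
Qed.

(** The compression of [y] to the span of one column of matrix units, which by
the KMS relation does not depend on the column. *)
Lemma conditional_expectation y : M y -> (forall v, `|y v| <= `|v|) ->
  exists2 y' : N nu, contr y' & forall z : N nu,
    inner (y (pi z Omega)) Omega = pairing alpha true y' z /\
    inner (pi z (y Omega)) Omega = pairing alpha false y' z.
Proof.
move=> My yc; have yb : bounded_op y by case: My.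
have s : 'I_(2 ^ nu) by apply: (Ordinal (_ : 0 < 2 ^ nu)%N); rewrite expn_gt0.
have dd0 q := density_gt0 halpha (q : 'I_(2 ^ nu)).
have ddn0 q : dd q != 0 by rewrite gt_eqF.
pose e p := Pi (E p s) Omega.
pose y' : N nu := \matrix_(q, p) (inner (y (e p)) (e q) / dd s).
have left_entry p q : inner (y (Pi (E p q) Omega)) Omega = dd q * y' q p.
  rewrite -(E_mul p s q) gnsM vn_kms // mxE /e.
  by field; rewrite ddn0.
have right_entry p q : inner (y Omega) (Pi (E q p) Omega) = dd p * y' q p.
  have := vn_kms cone p q My; rewrite (gns_one hGNS) left_entry => h.
  have -> : inner (y Omega) (Pi (E q p) Omega) = dd p / dd q * (dd q * y' q p).
    by rewrite h; field; rewrite !ddn0.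
  by field; rewrite ddn0.
exists y' => [v|z].
  have e_orth p q : inner (e p) (e q) = (p == q)%:R * dd s.
    rewrite gns_phi E_star // -(limit_mul hA) // hind // mul_delta_mx_cond rhoE.
    rewrite (bigD1 s) //= [X in _ + X]big1 => [|k nk].
      by rewrite addr0 mulmxnE mxE !eqxx eq_sym.
    by rewrite mulmxnE mxE (negbTE nk) mul0rn mul0r.
  pose f := \sum_p v p 0 *: e p.
  have yf q : (y' *m v) q 0 = inner (y f) (e q) / dd s.
    rewrite mxE bounded_op_sum // inner_suml big_distrl /=.
    apply: eq_bigr => p _; rewrite mxE bounded_opZ // innerZl; ring.
  have nf : `|f| ^+ 2 = dd s * sqn v.
    rewrite -inner_norm [in LHS]/f inner_suml big_distrr /=.
    apply: eq_bigr => p _; rewrite innerZl inner_sumr (bigD1 p) //=.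
    rewrite [X in _ + X]big1 => [|q nq].
      by rewrite addr0 innerZr e_orth eqxx mul1r mulrA -normCK mulrC.
    by rewrite innerZr e_orth eq_sym (negbTE nq) mul0r mulr0.
  have B := bessel (y f) (dd0 s) e_orth.
  rewrite -(ler_pM2l (dd0 s)) -nf.
  apply: le_trans (_ : `|y f| ^+ 2 <= _); last by rewrite ler_sqr ?nnegrE.
  rewrite -(ler_pM2l (dd0 s)); apply: le_trans B.
  rewrite /sqn mulrA big_distrr /=; apply: ler_sum => q _.
  rewrite yf normrM exprMn normfV (gtr0_norm (dd0 s)) -expr2.
  rewrite mulrCA -exprMn divff ?ddn0 // expr1n mulr1 //.
rewrite !pi_entries bounded_op_sum // !inner_suml; split; apply: eq_bigr => p _.
  rewrite bounded_op_sum // inner_suml; apply: eq_bigr => q _.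
  by rewrite bounded_opZ // innerZl left_entry /weight /=; ring.
rewrite inner_suml; apply: eq_bigr => q _.
rewrite innerZl (gns_star hGNS) E_star right_entry /weight /=; ring.
Qed.

(** With [c^* c = 1 - y^* y], the squared norms of [y v] and [c v] add up to that
of [v]. *)
Lemma contr_pi (y : N nu) : contr y -> forall v, `|pi y v| <= `|v|.
Proof.
move=> /contr_defect[c ec] v; rewrite -ler_sqr ?nnegrE //.
have sq (x : N nu) : `|pi x v| ^+ 2 = inner (pi (adj_mx x *m x) v) v.
  by rewrite -inner_norm gns_inner -(limit_star hA) // -(limit_mul hA).
have := congr1 (fun x => inner (pi x v) v) ec.
rewrite /= iotaD gnsD innerDl -!sq (limit_one hA) // (gns_one hGNS) inner_norm.
by move=> <-; rewrite lerDl exprn_ge0.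
Qed.

Lemma rho_pi (x : N nu) : vector_state Omega (pi x) = rho alpha x.
Proof. by rewrite /vector_state -(gns_state hGNS) hind. Qed.

Lemma pi_comp (x y : N nu) : pi x \o pi y = pi (x *m y).
Proof. by rewrite (limit_mul hA) // (gns_mul hGNS). Qed.

End Level.

(** * The sharp and flat norms *)

Lemma vn_Pi a : M (Pi a).
Proof.
split=> [|x [_ xc]]; first exact: gns_bounded hGNS a.
by rewrite xc //; exists a.
Qed.

Lemma vn_lin c x y : M x -> M y -> M (c *: x + y).
Proof.
move=> [xb xc] [yb yc]; have fE v : (c *: x + y) v = c *: x v + y v by [].
have [xl _] := xb; have [yl _] := yb.
split=> [|z cz]; last first.
  have [[zl _] _] := cz; apply: funext => v.
  have := congr1 (@^~ v) (xc _ cz); have := congr1 (@^~ v) (yc _ cz) => /= ey ex.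
  by rewrite /= !fE ey ex zl.
have [K K0 hK] := bounded_opP xb; have [L L0 hL] := bounded_opP yb.
apply: (@bounded_opI _ _ _ (`|c| * K + L)) => [|k u v|v].
- by rewrite addr_ge0 // mulr_ge0.
- rewrite !fE xl yl !scalerDr !scalerA (mulrC c) -!scalerA.
  by rewrite addrACA.
- rewrite fE (le_trans (ler_normD _ _)) // normrZ mulrDl -mulrA lerD //.
  by rewrite ler_wpM2l.
Qed.

(** The sides are encoded as for [pairing]. *)
Definition side_norm (s : bool) : (H -> H) -> R :=
  if s then sharp_norm M (vector_state Omega) else flat_norm M (vector_state Omega).

Definition side_functional (s : bool) (x y : H -> H) : C :=
  if s then inner (y (x Omega)) Omega else inner (x (y Omega)) Omega.

Lemma side_normE s x : side_norm s x = sup [set complex.Re `|side_functional s x y|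
  | y in [set y | M y /\ forall v, `|y v| <= `|v|]].
Proof. by rewrite /side_norm; case: s. Qed.

Lemma side_functional_bounded s x : M x -> exists2 K : C, 0 <= K &
  forall y, (forall v, `|y v| <= `|v|) -> `|side_functional s x y| <= K.
Proof.
move=> [/bounded_opP[K K0 hK] _]; exists K => // y yc; rewrite /side_functional.
case: s; rewrite (le_trans (cauchy_schwarz _ _)) // norm_Omega mulr1.
  by rewrite (le_trans (yc _)) // (le_trans (hK _)) // norm_Omega mulr1.
rewrite (le_trans (hK _)) // -[leRHS]mulr1 ler_wpM2l //.
by rewrite (le_trans (yc _)) // norm_Omega.
Qed.

Lemma side_norm_ub s x y : M x -> M y -> (forall v, `|y v| <= `|v|) ->
  `|side_functional s x y| <= (side_norm s x)%:C.
Proof.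
move=> Mx My yc; have [K K0 hK] := side_functional_bounded s Mx.
rewrite -[leLHS]RRe_real ?normr_real // lecR side_normE.
apply: ub_le_sup; last by exists y.
exists (complex.Re K) => _ [z [_ zc] <-].
rewrite -lecR !RRe_real ?ger0_real ?hK //.
Qed.

Lemma side_norm_le s x (K : C) : 0 <= K ->
  (forall y, M y -> (forall v, `|y v| <= `|v|) -> `|side_functional s x y| <= K) ->
  (side_norm s x)%:C <= K.
Proof.
move=> K0 h; rewrite -[leRHS]RRe_real ?ger0_real // lecR side_normE.
apply: ge_sup.
  exists (complex.Re `|side_functional s x (Pi cone)|), (Pi cone) => //.
  by split; [exact: vn_Pi | rewrite (gns_one hGNS)].
move=> _ [y [My yc] <-]; rewrite -lecR !RRe_real ?ger0_real //.
exact: h.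
Qed.

(** The norm duality between levels and the algebra: contractions of level [nu]
are contractions of the algebra, and the conditional expectation goes back. *)
Lemma pairing_side_norm s nu (y z : N nu) : (0 < nu)%N -> contr y ->
  `|pairing alpha s y z| <= (side_norm s (pi z))%:C.
Proof.
move=> nu0 cy.
have := @side_norm_ub s (pi z) (pi y) (vn_Pi _) (vn_Pi _) (contr_pi nu0 cy).
suff -> : side_functional s (pi z) (pi y) = pairing alpha s y z by [].
rewrite pairing_rho /side_functional.
by case: s; rewrite -(rho_pi nu0) -pi_comp.
Qed.

Lemma side_norm_pi_le s nu (z : N nu) K : (0 < nu)%N ->
  bounded_pairing alpha s z K -> (side_norm s (pi z))%:C <= K.
Proof.
move=> nu0 b; apply: side_norm_le; first exact: bounded_pairing_ge0 b.
move=> y My yc; have [y' cy' /(_ z)[l r]] := conditional_expectation nu0 My yc.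
by rewrite /side_functional; case: s b => b; rewrite ?l ?r; exact: b.
Qed.

(** For the sharp norm [x Omega] is approximated; for the flat norm a vector that
nearly represents [v |-> inner (x v) Omega], whence the adjoint of [z]. *)
Lemma dense_levels s x (eps : C) : M x -> 0 < eps ->
  exists nu (z : N nu), (0 < nu)%N /\ (side_norm s (- 1 *: pi z + x))%:C <= eps.
Proof.
move=> [xb xc] e0.
have diffE nu (z : N nu) v : (- 1 *: pi z + x) v = x v - pi z v.
  by rewrite [RHS]addrC -[- pi z v]scaleN1r.
case: s.
  have [nu [z [nu0 hz]]] := pi_approx (x Omega) e0.
  exists nu, z; split=> //; apply: side_norm_le => [|y _ yc]; first exact: ltW.
  rewrite (le_trans (cauchy_schwarz _ _)) // norm_Omega mulr1 (le_trans (yc _)) //.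
  by rewrite diffE ltW.
have e2 : 0 < eps / 2 by rewrite divr_gt0.
have [K K0 hK] := bounded_opP xb.
have [w hw] : exists w, forall v, `|inner (x v) Omega - inner v w| <= eps / 2 * `|v|.
  apply: (approximate_riesz _ K0) => // [c u v|v].
    by rewrite xb.1 innerDl innerZl.
  by rewrite (le_trans (cauchy_schwarz _ _)) // norm_Omega mulr1 hK.
have [nu [z [nu0 hz]]] := pi_approx w e2.
exists nu, (adj_mx z); split=> //; apply: side_norm_le => [|y _ yc]; first exact: ltW.
set v := y Omega; have v1 : `|v| <= 1 by rewrite (le_trans (yc _)) // norm_Omega.
have -> : side_functional false (-1 *: pi (adj_mx z) + x) y =
    (inner (x v) Omega - inner v w) + inner v (w - pi z Omega).
  rewrite innerBr addrA subrK /side_functional diffE.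
  by rewrite innerBl (gns_star hGNS) (limit_star hA) // starK.
rewrite (le_trans (ler_normD _ _)) // [eps]splitr lerD //.
  by rewrite (le_trans (hw _)) // -[leRHS]mulr1 ler_wpM2l // ltW.
rewrite (le_trans (cauchy_schwarz _ _)) // -[leRHS]mul1r.
by rewrite ler_pM // ltW.
Qed.

(** * The Haar basis *)

Section Basis.
Variables (s : bool) (r : 'I_4 -> N 1).
Hypothesis r0 : r ord0 = 1%:M.
Hypothesis r_orthonormal :
  forall q k, pairing alpha s (adj_mx (r q)) (r k) = (q == k)%:R.
Variables (B : completeNormedModType C) (jmath : (H -> H) -> B).
Hypothesis hB : is_completion M (side_norm s) jmath.
Local Notation h := (haar_limit (fun nu (x : N nu) => pi x) r).

Lemma jmath_linear nu (nu0 : (0 < nu)%N) c (x y : N nu) :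
  jmath (pi (c *: x + y)) = c *: jmath (pi x) + jmath (pi y).
Proof.
rewrite -(completion_linear hB) //; [|exact: vn_Pi..].
by congr jmath; rewrite (limit_linear hA nu0) (gns_linear hGNS).
Qed.

Lemma jmath_sum nu (nu0 : (0 < nu)%N) (I : finType) (c : I -> C) (x : I -> N nu) :
  jmath (pi (\sum_k c k *: x k)) = \sum_k c k *: jmath (pi (x k)).
Proof.
pose F (x : N nu) := jmath (pi x).
have FD : {morph F : x y / x + y}.
  by move=> u v; have := jmath_linear nu0 1 u v; rewrite !scale1r.
have F0 : F 0 = 0.
  by have := jmath_linear nu0 (-1) 0 0; rewrite !scaleN1r !addNr.
rewrite -/(F _) (big_morph F FD F0); apply: eq_bigr => k _.
by have := jmath_linear nu0 (c k) (x k) 0; rewrite -/(F 0) F0 !addr0.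
Qed.

Lemma haar_limit_level nu k : (0 < nu)%N -> (k < 4 ^ nu)%N ->
  h k = pi (haar r nu k).
Proof.
move=> nu0 hk; apply: haar_limitE => // mu mu0 x.
by rewrite (limit_compat hA).
Qed.

Lemma partial_sum_level nu n c : (0 < nu)%N -> (n <= 4 ^ nu)%N ->
  \sum_(0 <= k < n) c k *: jmath (h k) = jmath (pi (haar_sum r nu (trunc n c))).
Proof.
move=> nu0 hn; rewrite jmath_sum // big_mkord.
rewrite [RHS](eq_bigr (fun k : 'I_(4 ^ nu) => if (k < n)%N then
  c k *: jmath (h k) else 0)) => [|k _]; last first.
  rewrite /trunc (haar_limit_level nu0 (ltn_ord k)); case: ifP => // _; exact: scale0r.
by rewrite -big_mkcond /= (big_ord_widen _ (fun k => c k *: jmath (h k)) hn).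
Qed.

Lemma jmath_norm nu (z : N nu) : `|jmath (pi z)| = (side_norm s (pi z))%:C.
Proof. by rewrite (completion_norm hB) //; exact: vn_Pi. Qed.

Theorem haar_schauder_basis : schauder_basis (fun k => jmath (h k)).
Proof.
pose g := dual_coef alpha s r.
have gd := dual_coefP r_orthonormal.
have gb := dual_coef_basis r_orthonormal.
have gc := orthonormal_centred r0 r_orthonormal.
have le4 m : (m < 4 ^ m.+1)%N by rewrite (ltn_trans (ltnSn m)) // ltn_expl.
apply: (@schauder_basis_criterion _ _ _ (basis_constant alpha r g s)).
- move=> k; rewrite (haar_limit_level (ltn0Sn k)) //.
  set z := haar r _ k.
  have z0 : z != 0 by exact: (haar_neq0 gd (le4 k)).
  rewrite -normr_gt0 lt_def normr_ge0 andbT; apply: contraNneq z0 => nz.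
  apply/eqP/matrixP => a b; apply/eqP; rewrite [X in _ == X]mxE.
  have := @pairing_side_norm s _ (delta_mx b a) z isT (contr_delta b a).
  rewrite -jmath_norm nz normr_le0 /pairing (bigD1 a) //= (bigD1 b) //=.
  rewrite mxE !eqxx mul1r [X in _ + X + _]big1 => [|c nc]; last first.
    by rewrite mxE (negbTE nc) mul0r.
  rewrite [X in _ + X]big1 => [|c nc]; last first.
    by rewrite big1 // => c' _; rewrite mxE (negbTE nc) andbF mul0r.
  by rewrite !addr0 mulf_eq0 gt_eqF ?weight_gt0.
- by rewrite (le_trans ler01) // basis_constant_ge1.
- move=> c n m nm; have hm := ltnW (le4 m).
  rewrite !(@partial_sum_level m.+1) ?(leq_trans nm) // !jmath_norm.
  apply: side_norm_pi_le => //.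
  have -> : haar_sum r m.+1 (trunc n c) = haar_sum r m.+1 (trunc n (trunc m c)).
    apply: eq_bigr => k _; rewrite /trunc; case: (ltnP k n) => // kn.
    by rewrite (leq_trans kn nm).
  apply: (bounded_pairing_trunc halpha r0 gd gc) => y cy.
  exact: pairing_side_norm.
- move=> b eps e0; have e2 : 0 < eps / 2 by rewrite divr_gt0.
  have [_ [x Mx <-] hx] := closureT_approx (completion_dense hB) b e2.
  have [nu [z [nu0 hz]]] := dense_levels s Mx e2.
  have [c zc] := haar_span gb z.
  exists c, (4 ^ nu)%N; rewrite (@partial_sum_level nu) //.
  have -> : haar_sum r nu (trunc (4 ^ nu) c) = z.
    by rewrite zc; apply: eq_bigr => k _; rewrite /trunc ltn_ord.
  have -> : b - jmath (pi z) = (b - jmath x) + (jmath x - jmath (pi z)).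
    by rewrite addrA subrK.
  rewrite (le_lt_trans (ler_normD _ _)) // [eps]splitr ltr_leD //.
  have -> : jmath x - jmath (pi z) = jmath (-1 *: pi z + x).
    by rewrite (completion_linear hB) ?scaleN1r 1?addrC //; exact: vn_Pi.
  by rewrite (completion_norm hB) //; apply: vn_lin => //; exact: vn_Pi.
Qed.

End Basis.
End PowersFactor.

Theorem theorem12 (R : realType) (alpha : R) (halpha : 0 < alpha <= 2^-1)
  (A : cstarAlgType R) (iota : forall nu, N R nu -> A)
  (hA : is_inductive_limit iota)
  (phi : A -> R[i]) (hphi : is_state phi)
  (hind : forall nu, (0 < nu)%N ->
     forall x : N R nu, phi (iota nu x) = rho alpha x)
  (H : hilbertType R) (Pi : A -> H -> H) (Omega : H)
  (hGNS : is_gns phi Pi Omega)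
  (r : 'I_4 -> N R 1) (hr0 : r ord0 = 1%:M) :
  let Ralpha := vn_generated (range Pi) in
  let rho_alpha := vector_state Omega in
  let pi nu (x : N R nu) := Pi (iota nu x) in
  let h := haar_limit pi r in
  (left_orthonormal alpha r ->
   forall (B : completeNormedModType R[i]) (jmath : (H -> H) -> B),
     is_completion Ralpha (sharp_norm Ralpha rho_alpha) jmath ->
     schauder_basis (fun k => jmath (h k))) /\
  (right_orthonormal alpha r ->
   forall (B : completeNormedModType R[i]) (jmath : (H -> H) -> B),
     is_completion Ralpha (flat_norm Ralpha rho_alpha) jmath ->
     schauder_basis (fun k => jmath (h k))).
Proof.
have h1 : 0 < alpha < 1.
  case/andP: halpha => -> /le_lt_trans -> //.
  by rewrite invf_lt1 // ltr1n.
move=> Ralpha rho_alpha pi h; split => ho B jmath hB.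
  apply: (haar_schauder_basis h1 hA hphi hind hGNS (s := true) hr0) => //.
  by move=> q k; rewrite pairing_rho; exact: ho.
apply: (haar_schauder_basis h1 hA hphi hind hGNS (s := false) hr0) => // q k.
by rewrite pairing_rho /= ho eq_sym.
Qed.
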